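(* Let $G$ be a countable infinite discrete amenable group, let $X$ be an infinite compact metrizable space, and let $\alpha: G\curvearrowright X$ be a minimal free continuous action of $G$ on $X$. Suppose that $E_G(X)$ is compact and zero-dimensional in the weak*-topology. Then $\alpha$ has the small boundary property.
   Context: $M_G(X)$ denotes the convex set of all $G$-invariant regular Borel probability measures on $X$, regarded as a weak*-compact subset of $C(X)^*$. $E_G(X)$ denotes the set of extreme points of $M_G(X)$ (equivalently, the ergodic measures in $M_G(X)$), with the subspace weak*-topology; zero-dimensional means covering dimension zero. An action $\alpha: G\curvearrowright X$ has the small boundary property if for every point $x\in X$ and every open set $U\ni x$ there is an open neighborhood $V\subset U$ of $x$ such that $\mu(\partial V)=0$ for every $\mu\in M_G(X)$, where $\partial V=\overline{V}\setminus V$ is the topological boundary. *)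

(* Defs.v *)
From HB Require Import structures.
From mathcomp Require Import all_boot all_order all_algebra.
From mathcomp Require Import all_classical all_reals all_analysis.

Set Implicit Arguments.
Unset Strict Implicit.
Unset Printing Implicit Defensive.

Import Order.TTheory GRing.Theory Num.Theory.
Import numFieldNormedType.Exports.

Local Open Scope classical_set_scope.
Local Open Scope ring_scope.

Definition metrizable (R : realType) (X : topologicalType) : Prop :=
  exists d : X -> X -> R,
    [/\ forall x y, 0 <= d x y,
        forall x y, d x y = 0 <-> x = y,
        forall x y, d x y = d y x &
        forall x y z, d x z <= d x y + d y z] /\
    forall U : set X, open U <->
      forall x, U x -> exists2 e : R, 0 < e & [set y | d x y < e] `<=` U.

(* [\dim T <= n]: every finite open cover has a finite open refinement such
   that no point lies in more than n + 1 of its members.  For n = 0 the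
   members of the refinement are pairwise disjoint; the empty space, for which the
   usual convention is dimension -1, also satisfies the bound. *)
Definition covering_dim_le (T : topologicalType) (n : nat) : Prop :=
  forall U : set (set T),
    finite_set U -> U `<=` open -> \bigcup_(A in U) A = [set: T] ->
  exists V : set (set T),
    [/\ finite_set V, V `<=` open, \bigcup_(B in V) B = [set: T],
        forall B, V B -> exists2 A, U A & B `<=` A &
        forall x : T, ([set B | V B /\ B x] #<= `I_n.+1)%card].

(* Day's definition: a left-invariant mean on the bounded functions on G.
   The values of m at unbounded functions are irrelevant. *)
Definition amenable (R : realType) (G : groupType) : Prop :=
  exists m : (G -> R) -> R,
    [/\ forall (a : R) (u v : G -> R), bounded_fun u -> bounded_fun v ->
          m (fun h => a * u h + v h) = a * m u + m v,
        forall u : G -> R, bounded_fun u -> (forall h, 0 <= u h) -> 0 <= m u,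
        m (fun=> 1) = 1 &
        forall (g : G) (u : G -> R), bounded_fun u ->
          m (fun h => u (g^-1 * h)%g) = m u].

Record continuous_action (G : groupType) (X : topologicalType) :=
  ContinuousAction {
    act :> G -> X -> X ;
    act1 : forall x, act 1%g x = x ;
    actM : forall g h x, act (g * h)%g x = act g (act h x) ;
    act_continuous : forall g, continuous (act g) }.

Definition free_action (G : groupType) (X : topologicalType)
    (alpha : continuous_action G X) : Prop :=
  forall g x, alpha g x = x -> g = 1%g.

Definition minimal_action (G : groupType) (X : topologicalType)
    (alpha : continuous_action G X) : Prop :=
  forall C : set X, closed C -> (forall g x, C x -> C (alpha g x)) ->
  C = set0 \/ C = [set: X].

(* The library's generated sigma-algebras need a pointed carrier; hence
   [ptopologicalType] below, which only excludes the empty space. *)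
Notation borel X := (g_sigma_algebraType (@open X)).

Definition regular_measure (R : realType) (X : ptopologicalType)
    (mu : probability (borel X) R) : Prop :=
  forall A : set (borel X), measurable A ->
    mu A = ereal_inf [set mu U | U in [set U : set X | open U /\ A `<=` U]] /\
    mu A = ereal_sup [set mu K | K in [set K : set X | compact K /\ K `<=` A]].

Definition invariant_measure (R : realType) (G : groupType)
    (X : ptopologicalType) (alpha : continuous_action G X)
    : set (probability (borel X) R) :=
  [set mu | regular_measure mu /\
    forall g (A : set (borel X)), measurable A -> mu (alpha g @^-1` A) = mu A].

(* The functionals on C(X), with the topology of pointwise convergence on
   C(X); on the dual of C(X) it induces the weak* topology. *)
Notation functionals R X := {ptws continuousType X R -> R}.

Definition functional_of (R : realType) (X : ptopologicalType)
    (mu : probability (borel X) R) : functionals R X :=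
  fun f => \int[mu]_x f x.

(* M_G(X) and E_G(X) consist of functionals, not of terms of type
   [probability]: two such terms can agree on all Borel sets and still differ,
   as their values at non-measurable sets are unconstrained. *)
Definition M_G (R : realType) (G : groupType) (X : ptopologicalType)
    (alpha : continuous_action G X) : set (functionals R X) :=
  @functional_of R X @` invariant_measure alpha.
Arguments M_G R {G X} alpha.

Definition extreme_points (I : Type) (R : realType) (K : set {ptws I -> R})
    : set {ptws I -> R} :=
  [set p | K p /\ forall (q r : {ptws I -> R}) (t : R),
    K q -> K r -> 0 < t < 1 ->
    p = (fun i => t * q i + (1 - t) * r i) -> q = p /\ r = p].

Definition E_G (R : realType) (G : groupType) (X : ptopologicalType)
    (alpha : continuous_action G X) : set (functionals R X) :=
  extreme_points (M_G R alpha).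
Arguments E_G R {G X} alpha.

Definition boundary (X : topologicalType) (V : set X) : set X :=
  closure V `\` V.

Definition small_boundary_property (R : realType) (G : groupType)
    (X : ptopologicalType) (alpha : continuous_action G X) : Prop :=
  forall (x : X) (U : set X), open U -> U x ->
  exists V : set X, [/\ open V, V x, V `<=` U &
    forall mu : probability (borel X) R,
      invariant_measure alpha mu -> mu (boundary V) = 0%E].

(* Main.v *)
(* By the Riesz representation theorem, [M_G] is the compact convex set of
invariant states of [C(X)], and a bound on a coordinate over its extreme points
[E_G] holds on all of [M_G] (Bauer). For [f] in [C(X)], pairwise disjointness
of the sets [f = - c_k] gives at each [q] in [E_G] a small shift [c] such that
[f + c] has a small neighborhood of its zero set of small [q]-measure; this is
an open condition on [q], so zero-dimensionality lets one choose
[c : E_G -> R] locally constant. It remains to realize [c] by a single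
continuous function [h] on [X] with [h] close to [c(q)] in [L^1(q)], uniformly
in [q]. The functions on [E_G] which can be so realized contain [q |-> q(k)]
for [k] in [C(X)], because averages of [k] over [G] converge to [q(k)] (mean
ergodic theorem, from extremality of [q]) and amenability makes the averages
uniform on the compact set [E_G]; they form a lattice, so by the
Kakutani-Stone argument they contain every locally constant function.
Replacing [f] by [f + h] and iterating, a uniformly convergent sequence of
perturbations of [f] produces a function whose zero set is null for every
invariant measure, and the boundary of its positivity set lies in that zero
set. *)

From HB Require Import structures.
Require Import Defs.
From mathcomp Require Import all_boot all_order all_algebra.
From mathcomp Require Import all_classical all_reals all_analysis.
From mathcomp Require Import measurable_realfun ring lra.

Set Implicit Arguments.
Unset Strict Implicit.
Unset Printing Implicit Defensive.
Import Order.TTheory GRing.Theory Num.Theory.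
Import numFieldNormedType.Exports.
Local Open Scope classical_set_scope.
Local Open Scope ring_scope.

(** ** Continuous functions and states *)

(** The obstacle is that a good shift depends on the measure, while one function must serve all
    invariant measures at once. Smallness is therefore never expressed by the measure of a zero set
    but by the integral of a Lipschitz cutoff of the function ([bump]). Such an integral is a single
    weak*-continuous coordinate of the functional, so smallness is open in q and passes from [E_G]
    to [M_G]. Being Lipschitz, it also tolerates a shift that is correct only in L^1(q). Uniformity
    in q is a gluing problem: two averages, each good on a part of [E_G], must be merged into one
    good on both. Amenability enters only here, as the fact that one further averaging brings any
    two averages of the same bounded function uniformly close, while averaging never moves a
    function further from a constant in L^1(q). Measures occur only at the two ends; in between
    everything is done with positive normalized linear functionals on C(X). *)

Section ContinuousFunctions.
Variables (R : realType) (X : topologicalType).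
Implicit Types f g : X -> R.

Lemma cts_add f g : continuous f -> continuous g ->
  continuous (fun x => f x + g x).
Proof. by move=> cf cg x; apply: continuousD; [exact: cf|exact: cg]. Qed.

Lemma cts_opp f : continuous f -> continuous (fun x => - f x).
Proof. by move=> cf x; apply: continuousN; exact: cf. Qed.

Lemma cts_mul f g : continuous f -> continuous g ->
  continuous (fun x => f x * g x).
Proof. by move=> cf cg x; apply: continuousM; [exact: cf|exact: cg]. Qed.

Lemma cts_cst (c : R) : continuous (fun _ : X => c).
Proof. exact: cst_continuous. Qed.

Lemma cts_exp f n : continuous f -> continuous (fun x => f x ^+ n).
Proof.
move=> cf; elim: n => [|n IH]; first exact: cts_cst.
by under eq_fun do rewrite exprS; exact: cts_mul.
Qed.

Lemma cts_norm f : continuous f -> continuous (fun x => `|f x|).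
Proof. by move=> cf x; apply: continuous_comp; [exact: cf|exact: norm_continuous]. Qed.

Lemma cts_max f g : continuous f -> continuous g ->
  continuous (fun x => Num.max (f x) (g x)).
Proof. by move=> cf cg x; apply: continuous_max; [exact: cf|exact: cg]. Qed.

Lemma cts_min f g : continuous f -> continuous g ->
  continuous (fun x => Num.min (f x) (g x)).
Proof. by move=> cf cg x; apply: continuous_min; [exact: cf|exact: cg]. Qed.

Lemma open_lt_continuous f c : continuous f -> open [set x | f x < c].
Proof. by move=> /continuousP cf; apply: (cf [set y | y < c]); exact: open_lt. Qed.

Lemma open_gt_continuous f c : continuous f -> open [set x | c < f x].
Proof. by move=> /continuousP cf; apply: (cf [set y | c < y]); exact: open_gt. Qed.

End ContinuousFunctions.

Arguments cts_cst {R X} c.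

Ltac cts := lazymatch goal with
  | |- forall _, continuous_at _ (fun x => GRing.add (@?f x) (@?g x)) =>
      refine (@cts_add _ _ f g _ _); cts
  | |- forall _, continuous_at _ (fun x => GRing.opp (@?f x)) =>
      refine (@cts_opp _ _ f _); cts
  | |- forall _, continuous_at _ (fun x => GRing.mul (@?f x) (@?g x)) =>
      refine (@cts_mul _ _ f g _ _); cts
  | |- forall _, continuous_at _ (fun x => GRing.exp (@?f x) ?n) =>
      refine (@cts_exp _ _ f n _); cts
  | |- forall _, continuous_at _ (fun x => Num.norm (@?f x)) =>
      refine (@cts_norm _ _ f _); cts
  | |- forall _, continuous_at _ (fun x => Num.max (@?f x) (@?g x)) =>
      refine (@cts_max _ _ f g _ _); cts
  | |- forall _, continuous_at _ (fun x => Num.min (@?f x) (@?g x)) =>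
      refine (@cts_min _ _ f g _ _); cts
  | |- forall _, continuous_at _ (fun _ => ?c) => refine (@cts_cst _ _ c)
  | _ => try assumption
  end.

(** Compactness as a local-to-global principle, used for all gluing arguments below. If [I K] fails,
    the sets whose complement in [K] belongs to [I] form a proper filter; a cluster point in [K]
    would have a neighborhood in [I], whose complement is in the filter. *)
Lemma compact_ideal (T : topologicalType) (K : set T) (I : set (set T)) :
  compact K -> I set0 ->
  (forall A B, I A -> I B -> I (A `|` B)) ->
  (forall A B, A `<=` B -> I B -> I A) ->
  (forall x, K x -> exists2 U, nbhs x U & I U) -> I K.
Proof.
move=> Kc I0 IU Isub Iloc; apply: contrapT => NIK.
pose F : set_system T := [set A | I (K `&` ~` A)].
have FF : ProperFilter F.
  apply: Build_ProperFilter_ex => [A FA|].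
    apply: contrapT => /forallNP A0; apply: NIK.
    by apply: Isub FA => x Kx; split=> // /A0.
  split.
  - by rewrite /F /= setCT setI0.
  - move=> A B FA FB; rewrite /F /= setCI setIUr; exact: IU.
  - by move=> A B AB; apply: Isub => x [Kx nBx]; split=> // /AB.
have FK : F K by rewrite /F /= setICr.
have [x [Kx clx]] := Kc F FF FK.
have [U Ux IUU] := Iloc x Kx.
have FU : F (~` U) by apply: Isub IUU => y [_]; rewrite setCK.
by have [y [nU Uy]] := clx _ _ FU Ux.
Qed.

Section States.
Variables (R : realType) (X : topologicalType).
Implicit Types f g : X -> R.

(** The functional takes bare functions, so no continuity proof has to be carried inside its
    argument; its values at discontinuous functions are unconstrained. *)
Record state (p : (X -> R) -> R) : Prop := State {
  stateP : forall a f g, continuous f -> continuous g ->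
    p (fun x => a * f x + g x) = a * p f + p g;
  state_ge0 : forall f, continuous f -> (forall x, 0 <= f x) -> 0 <= p f;
  state1 : p (fun=> 1) = 1 }.

Variables (p : (X -> R) -> R) (sp : state p).

Lemma state0 : p (fun=> 0) = 0.
Proof.
have := stateP sp 1 (cts_cst (0:R)) (cts_cst (0:R)).
rewrite (_ : (fun x : X => 1 * 0 + 0) = fun=> 0); first by lra.
by apply/funext => x; rewrite mulr0 addr0.
Qed.

Lemma stateZ a f : continuous f -> p (fun x => a * f x) = a * p f.
Proof.
move=> cf; have := stateP sp a cf (cts_cst (0:R)).
by rewrite state0 addr0 => <-; congr p; apply/funext => x; rewrite addr0.
Qed.

Lemma stateD f g : continuous f -> continuous g ->
  p (fun x => f x + g x) = p f + p g.
Proof.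
move=> cf cg; have := stateP sp 1 cf cg.
by rewrite mul1r => <-; congr p; apply/funext => x; rewrite mul1r.
Qed.

Lemma stateN f : continuous f -> p (fun x => - f x) = - p f.
Proof.
move=> cf; rewrite -mulN1r -stateZ//; congr p.
by apply/funext => x; rewrite mulN1r.
Qed.

Lemma stateB f g : continuous f -> continuous g ->
  p (fun x => f x - g x) = p f - p g.
Proof. by move=> cf cg; rewrite (@stateD f (fun x => - g x)) ?stateN//; exact: cts_opp. Qed.

Lemma state_cst c : p (fun=> c) = c.
Proof.
by have := stateZ c (cts_cst (1:R)); rewrite (state1 sp) mulr1.
Qed.

Lemma le_state f g : continuous f -> continuous g -> (forall x, f x <= g x) ->
  p f <= p g.
Proof.
move=> cf cg fg; rewrite -subr_ge0 -stateB//; apply: state_ge0 => //.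
  by cts.
by move=> x; rewrite subr_ge0.
Qed.

Lemma ler_norm_state f : continuous f -> `|p f| <= p (fun x => `|f x|).
Proof.
move=> cf; rewrite ler_norml -stateN; last by cts.
by apply/andP; split; apply: le_state; cts => x; rewrite ?ler_norm// lerNl -normrN ler_norm.
Qed.

Lemma state_bounded f c : continuous f -> (forall x, `|f x| <= c) -> `|p f| <= c.
Proof.
move=> cf fc; rewrite (le_trans (ler_norm_state cf))// -[leRHS](state_cst c).
by apply: le_state; cts.
Qed.

Lemma state_sum n (F : nat -> X -> R) : (forall i, continuous (F i)) ->
  p (fun x => \sum_(i < n) F i x) = \sum_(i < n) p (F i).
Proof.
move=> cF; suff [] : continuous (fun x => \sum_(i < n) F i x) /\
  p (fun x => \sum_(i < n) F i x) = \sum_(i < n) p (F i) by [].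
elim: n => [|n [cn IH]].
  under eq_fun do rewrite big_ord0.
  by rewrite state0 big_ord0; split => //; exact: cts_cst.
under eq_fun do rewrite big_ord_recr /=.
by rewrite big_ord_recr/= -IH stateD//; split => //; apply: cts_add.
Qed.

(** The Cauchy-Schwarz inequality against the constant 1, obtained by integrating 2 d |t| <= t^2 +
    d^2. *)
Lemma state_norm_le f d : continuous f -> 0 < d -> p (fun x => f x ^+ 2) <= d ^+ 2 ->
  p (fun x => `|f x|) <= d.
Proof.
move=> cf d0 fd.
suff : 2 * d * p (fun x => `|f x|) <= d ^+ 2 + d ^+ 2.
  by move=> h; rewrite -(ler_pM2l d0); move: h; rewrite expr2; lra.
rewrite -stateZ; last by cts.
apply: le_trans (_ : p (fun x => f x ^+ 2 + d ^+ 2) <= _).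
  apply: le_state; cts => x.
  rewrite -real_normK ?num_real//.
  have := sqr_ge0 (`|f x| - d); lra.
by rewrite stateD ?state_cst; [lra|cts..].
Qed.

Lemma state_mul_le f g B d : continuous f -> continuous g -> 0 < d -> 0 <= B ->
  (forall x, `|f x| <= B) -> p (fun x => g x ^+ 2) <= d ^+ 2 ->
  `|p (fun x => f x * g x)| <= B * d.
Proof.
move=> cf cg d0 B0 fB gd; apply: le_trans (ler_norm_state _) _; cts.
apply: le_trans (_ : p (fun x => B * `|g x|) <= _).
  by apply: le_state; cts => x; rewrite normrM ler_wpM2r.
rewrite stateZ; last by cts.
by rewrite ler_wpM2l//; exact: state_norm_le.
Qed.

End States.

(** ** Riesz representation *)

Section OpenSupport.
Variables (R : realType) (X : topologicalType).

(** Every open set is a cozero set. This is the form in which metrizability enters the argument. *)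
Definition perfect_space := forall U : set X, open U ->
  exists f : X -> R, [/\ continuous f, forall x, 0 <= f x & forall x, U x <-> 0 < f x].

Lemma metrizable_perfect : metrizable R X -> perfect_space.
Proof.
move=> [d [[d0 ds dC dT] dO]] U oU.
(* [inf (S x)] is the distance to the complement of [U], truncated at 1; the element 1 keeps [S x]
   nonempty when [U] is the whole space. *)
pose S x := [set r | r = 1 \/ exists2 y, ~ U y & r = d x y].
have Slb x : lbound (S x) 0 by move=> r [->|[y _ ->]].
have S0 x : S x !=set0 by exists 1; left.
have Sinf x : has_inf (S x) by split; [exact: S0|exists 0; exact: Slb].
have infS x y : inf (S x) <= inf (S y) + d x y.
  rewrite -lerBlDr; apply: lb_le_inf => // r [->|[z Uz ->]]; rewrite lerBlDr.
    apply: le_trans (_ : 1 <= _); last by rewrite lerDl.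
    by apply: ge_inf; [by case: (Sinf x)|left].
  rewrite addrC; apply: le_trans (dT x y z).
  by apply: ge_inf; [by case: (Sinf x)|right; exists z].
exists (fun x => inf (S x)); split.
- move=> x; apply/cvgrPdist_lt => e e0.
  have oB : open [set y | d x y < e].
    apply/dO => y /= xy; exists (e - d x y); first by rewrite subr_gt0.
    by move=> z /= yz; rewrite (le_lt_trans (dT x y z))// -ltrBrDl.
  have : nbhs x [set y | d x y < e].
    by apply: open_nbhs_nbhs; split=> //=; rewrite (ds x x).2.
  apply: filterS => y /= xy; apply: le_lt_trans xy.
  rewrite ler_distlC lerBlDr infS/= dC; exact: infS.
- by move=> x; apply: lb_le_inf.
- move=> x; split=> [Ux|Sx].
    have [e e0 eU] := (dO U).1 oU x Ux.
    apply: lt_le_trans (_ : Num.min 1 e <= _); first by rewrite lt_min ltr01.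
    apply: lb_le_inf => // r [->|[y nUy ->]]; rewrite ge_min ?lexx// (leNgt e).
    by apply/orP; right; apply/negP => xy; exact: (nUy (eU y xy)).
  apply: contrapT => nUx; move: Sx; rewrite ltNge => /negP; apply.
  apply: ge_inf; first by case: (Sinf x).
  by right; exists x => //; rewrite (ds x x).2.
Qed.

End OpenSupport.

Section RieszOuterMeasure.
Variables (R : realType) (X : topologicalType) (p : (X -> R) -> R).
Hypotheses (sp : state p) (cX : compact [set: X]) (perf : perfect_space R X).

(** The usual requirement that the support lie in [U] is weakened to vanishing off [U], which the
    truncations min(1, N u) of a function [u] with cozero set [U] satisfy. *)
Definition subordinate (U : set X) (f : X -> R) :=
  [/\ continuous f, forall x, 0 <= f x <= 1 & forall x, ~ U x -> f x = 0].

Definition inner_content (U : set X) : \bar R :=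
  ereal_sup [set (p f)%:E | f in subordinate U].

Definition outer_content (A : set X) : \bar R :=
  ereal_inf [set inner_content U | U in [set U | open U /\ A `<=` U]].

Lemma subordinate_cst0 U : subordinate U (fun=> 0).
Proof. by split => //; [exact: cts_cst|move=> x; rewrite lexx ler01]. Qed.

Lemma subordinate_le_content U f : subordinate U f -> ((p f)%:E <= inner_content U)%E.
Proof. by move=> Uf; apply: ereal_sup_ubound; exists f. Qed.

Lemma inner_content_le U V : U `<=` V -> (inner_content U <= inner_content V)%E.
Proof.
move=> UV; apply: ereal_sup_le => _ [f [cf f01 f0] <-]; exists f => //.
by split => // x nVx; apply: f0 => /UV.
Qed.

Lemma inner_content_ge0 U : (0 <= inner_content U)%E.
Proof. by have := subordinate_le_content (subordinate_cst0 U); rewrite (state0 sp). Qed.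

Lemma inner_content_le1 U : (inner_content U <= 1)%E.
Proof.
apply: ge_ereal_sup => _ [f [cf f01 _] <-]; rewrite lee_fin -(state1 sp).
by apply: (le_state sp) => //; [exact: cts_cst|move=> x; case/andP: (f01 x)].
Qed.

Lemma inner_content_fin_num U : inner_content U \is a fin_num.
Proof.
by rewrite ge0_fin_numE ?inner_content_ge0// (le_lt_trans (inner_content_le1 U))// ltry.
Qed.

Lemma inner_contentT : inner_content [set: X] = 1%E.
Proof.
have sub1 : subordinate [set: X] (fun=> 1).
  by split=> [|x|x /(_ I)//]; [exact: cts_cst|rewrite ler01 lexx].
have := subordinate_le_content sub1; rewrite (state1 sp) => le1.
by apply/eqP; rewrite eq_le inner_content_le1.
Qed.

Lemma inner_content0 : inner_content set0 = 0%E.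
Proof.
apply/eqP; rewrite eq_le inner_content_ge0 andbT.
apply: ge_ereal_sup => _ [f [cf f01 f0] <-].
by rewrite (_ : f = fun=> 0) ?(state0 sp)//; apply/funext => x; exact: f0.
Qed.

(** A Dini argument replaces partitions of unity. The functions [phi n N] increase in [N] to the
    indicator of [F n]. Near a point where [f < e] nothing is needed; any other point lies in some
    [F n], and [phi n N] equals 1 around it for large [N]. Compactness then gives [f <= S N + e]
    everywhere for one [N]. *)
Lemma inner_content_bigcup (F : nat -> set X) : (forall n, open (F n)) ->
  (inner_content (\bigcup_n F n) <= \sum_(n <oo) inner_content (F n))%E.
Proof.
move=> oF; have /choice[u uP] n := perf (oF n).
pose phi n N x := Num.min 1 (N%:R * u n x).
have cphi n N : continuous (phi n N).
  by case: (uP n) => cu _ _; rewrite /phi; cts.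
have phi0 n N x : 0 <= phi n N x.
  by case: (uP n) => _ u0 _; rewrite le_min ler01/= mulr_ge0.
have phi1 n N x : phi n N x <= 1 by rewrite ge_min lexx.
have phi_le n N M x : (N <= M)%N -> phi n N x <= phi n M x.
  move=> NM; case: (uP n) => _ u0 _; rewrite le_min phi1 /= ge_min.
  by rewrite ler_wpM2r ?orbT ?ler_nat.
have subphi n N : subordinate (F n) (phi n N).
  split => // [x|x nFx]; first by rewrite phi0 phi1.
  have ux : u n x = 0.
    case: (uP n) => _ u0 uF; apply/eqP; rewrite eq_le u0 andbT leNgt.
    by apply/negP => /uF.
  by rewrite /phi ux mulr0 minEle ler10.
apply: ge_ereal_sup => _ [f [cf f01 f0] <-]; apply/lee_addgt0Pr => e e0.
pose S N x := \sum_(n < N) phi n N x.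
have S_le N M x : (N <= M)%N -> S N x <= S M x.
  move=> NM; rewrite /S -!(big_mkord xpredT (fun n => phi n _ x)).
  rewrite (big_cat_nat (n := N) (p := M))//= -[leLHS]addr0 lerD//.
    by apply: ler_sum => i _; exact: phi_le.
  by apply: sumr_ge0.
have [N fS] : exists N, forall x, [set: X] x -> f x <= S N x + e.
  apply: (@compact_ideal _ [set: X] (fun Z => exists N, forall x, Z x -> f x <= S N x + e)) => //.
  - by exists 0%N.
  - move=> A B [N AN] [M BM]; exists (maxn N M) => x [Ax|Bx].
      by apply: le_trans (AN x Ax) _; rewrite lerD2r S_le// leq_maxl.
    by apply: le_trans (BM x Bx) _; rewrite lerD2r S_le// leq_maxr.
  - by move=> A B AB [N BN]; exists N => x /AB; exact: BN.
  - move=> x _; have [fx|fx] := ltP (f x) e.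
      exists [set y | f y < e].
        by apply: open_nbhs_nbhs; split => //; exact: open_lt_continuous.
      by exists 0%N => y /= fy; rewrite /S big_ord0 add0r ltW.
    have [n _ Fnx] : (\bigcup_n F n) x.
      by apply: contrapT => /f0 fx0; move: fx; rewrite fx0 leNgt e0.
    case: (uP n) => cu u0 /(_ x)[/(_ Fnx) ux _].
    pose N := maxn n.+1 (Num.truncn (u n x)^-1).+1.
    have Nu : 1 < N%:R * u n x.
      rewrite -ltr_pdivrMr// mul1r; apply: lt_le_trans (truncnS_gt _) _.
      by rewrite ler_nat leq_maxr.
    exists [set y | 1 < N%:R * u n y].
      by apply: open_nbhs_nbhs; split => //; apply: open_gt_continuous; cts.
    exists N => y /= Ny; apply: le_trans (_ : 1 <= _).
      by case/andP: (f01 y).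
    have nN : (n < N)%N by rewrite leq_max leqnn.
    rewrite /S (bigD1 (Ordinal nN))//= {1}/phi.
    rewrite (_ : Num.min _ _ = 1); last by rewrite minEle (ltW Ny).
    by rewrite -addrA lerDl addr_ge0 ?(ltW e0)// sumr_ge0.
apply: le_trans (_ : (\sum_(n < N) p (phi n N) + e)%:E <= _)%E.
  rewrite lee_fin -(state_sum sp _ (fun i => cphi i N)) -[X in _ <= _ + X](state_cst sp).
  have cS : continuous (S N).
    suff cSk k : continuous (fun x => \sum_(n < k) phi n N x) by exact: cSk.
    elim: k => [|k IH]; first by under eq_fun do rewrite big_ord0; exact: cts_cst.
    by under eq_fun do rewrite big_ord_recr/=; exact: cts_add.
  by rewrite -(stateD sp)//; [apply: (le_state sp) => //; cts => x; exact: fS|cts].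
rewrite EFinD leeD2r// -sumEFin.
apply: le_trans (_ : (\sum_(n < N) inner_content (F n) <= _)%E).
  by apply: lee_sum => i _; exact: subordinate_le_content.
rewrite -(big_mkord xpredT (fun n => inner_content (F n))).
by apply: nneseries_lim_ge => n _ _; exact: inner_content_ge0.
Qed.

Lemma outer_content_open U : open U -> outer_content U = inner_content U.
Proof.
move=> oU; apply/eqP; rewrite eq_le; apply/andP; split.
  by apply: ereal_inf_lbound; exists U => //; split.
by apply: le_ereal_inf_tmp => _ [V [oV UV] <-]; exact: inner_content_le.
Qed.

Lemma outer_content_le A B : A `<=` B -> (outer_content A <= outer_content B)%E.
Proof.
move=> AB; apply: ereal_inf_le_tmp => _ [U [oU BU] <-]; exists U => //.
by split => //; exact: subset_trans BU.
Qed.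

Lemma outer_content_ge0 A : (0 <= outer_content A)%E.
Proof. by apply: le_ereal_inf_tmp => _ [U _ <-]; exact: inner_content_ge0. Qed.

Lemma outer_content_fin_num A : outer_content A \is a fin_num.
Proof.
rewrite ge0_fin_numE ?outer_content_ge0//.
apply: le_lt_trans (outer_content_le (@subsetT _ A)) _.
by rewrite outer_content_open ?inner_contentT ?ltry//; exact: openT.
Qed.

Lemma outer_content_adherent A (e : R) : 0 < e ->
  exists U, [/\ open U, A `<=` U & (inner_content U <= outer_content A + e%:E)%E].
Proof.
move=> e0; have [_ [U [oU AU] <-] lt] := lb_ereal_inf_adherent e0 (outer_content_fin_num A).
by exists U; split => //; exact: ltW.
Qed.

Lemma outer_content_sigma_subadditive : sigma_subadditive outer_content.
Proof.
move=> A; apply/lee_addgt0Pr => e e0.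
have eVn_gt0 n : 0 < e / (2 ^ n.+1)%:R by rewrite divr_gt0// ltr0n expn_gt0.
have /choice[U UP] n := outer_content_adherent (A n) (eVn_gt0 n).
apply: le_trans (epsilon_trick _ _ (ltW e0)); last by move=> n; exact: outer_content_ge0.
apply: le_trans (_ : (\sum_(n <oo) inner_content (U n) <= _)%E); last first.
  by apply: lee_nneseries => [n _ _|n _]; [exact: inner_content_ge0|case: (UP n)].
apply: le_trans (inner_content_bigcup _); last by move=> n; case: (UP n).
rewrite -outer_content_open; last by apply: bigcup_open => n _; case: (UP n).
apply: outer_content_le => x [n _ Anx]; exists n => //.
by case: (UP n) => _ + _; exact.
Qed.

(** Almost optimal functions for the two pieces are made to live on disjoint sets: [f] is lowered by
    [e / 3] and cut at 0, while [g] vanishes wherever [f >= e / 3]. Their sum is thus still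
    subordinate to [V]. The error [e] is spent in thirds on [f], on [g] and on the lowering. *)
Lemma outer_content_additive_open U A : open U ->
  (outer_content (A `&` U) + outer_content (A `&` ~` U) <= outer_content A)%E.
Proof.
move=> oU; apply: le_ereal_inf_tmp => _ [V [oV AV] <-].
apply/lee_addgt0Pr => e e0.
have oVU : open (V `&` U) by exact: openI.
apply: le_trans (_ : outer_content (V `&` U) + outer_content (V `&` ~` U) <= _)%E.
  by rewrite leeD//; apply: outer_content_le; exact: setSI.
rewrite outer_content_open//.
have e3 : 0 < e / 3 by rewrite divr_gt0.
have [_ [f [cf f01 f0] <-] flt] := ub_ereal_sup_adherent e3 (inner_content_fin_num (V `&` U)).
pose W := V `&` [set x | f x < e / 3].
have oW : open W.
  by apply: openI => //; exact: open_lt_continuous.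
have [_ [g [cg g01 g0] <-] glt] := ub_ereal_sup_adherent e3 (inner_content_fin_num W).
have VW : (outer_content (V `&` ~` U) <= inner_content W)%E.
  rewrite -outer_content_open//; apply: outer_content_le => x [Vx nUx]; split => //=.
  by rewrite f0// => -[].
apply: le_trans (leeD2l _ VW) _.
pose f' x := Num.max 0 (f x - e / 3).
have cf' : continuous f' by rewrite /f'; cts.
have : ((p (fun x => f' x + g x))%:E <= inner_content V)%E.
  apply: subordinate_le_content; split; first by cts.
    move=> x; have /andP[fx0 fx1] := f01 x; have /andP[gx0 gx1] := g01 x.
    rewrite /f'; case: (leP 0 (f x - e / 3)) => fe; last by rewrite add0r gx0.
    rewrite g0 ?addr0; last by move=> [_ /=]; lra.
    by apply/andP; split; lra.
  move=> x nVx; rewrite g0 ?addr0; last by move=> [].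
  by rewrite /f' f0 ?sub0r; [apply/max_idPl; lra|move=> []].
rewrite (stateD sp)//; move: flt glt; rewrite -/(inner_content _) -/(inner_content W).
have : p f - e / 3 <= p f'.
  rewrite -[X in p f - X](state_cst sp) -(stateB sp)//; last by cts.
  by apply: (le_state sp) => //; [cts|move=> x; rewrite le_max lexx orbT].
rewrite -(fineK (inner_content_fin_num (V `&` U))) -(fineK (inner_content_fin_num W)).
rewrite -(fineK (inner_content_fin_num V)) -!EFinB !lte_fin -!EFinD !lee_fin; lra.
Qed.

End RieszOuterMeasure.

(** * Integrals of continuous functions against Borel probability measures *)

Section BorelMeasures.
Variables (R : realType) (X : ptopologicalType).

Lemma open_borel (U : set X) : open U -> measurable (U : set (borel X)).
Proof. by move=> oU; apply: sub_sigma_algebra. Qed.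

Lemma closed_borel (C : set X) : closed C -> measurable (C : set (borel X)).
Proof.
by move=> cC; rewrite -[C]setCK; apply: measurableC; apply: open_borel; exact: closed_openC.
Qed.

Lemma continuous_borel_measurable (f : X -> R) : continuous f ->
  measurable_fun [set: borel X] (f : borel X -> R).
Proof.
move=> cf; apply: (measurability _ (RGenOInfty.measurableE R)) => _ [_ [r ->] <-].
rewrite setTI; apply: open_borel.
by move/continuousP : cf; apply; exact: interval_open.
Qed.

Hypothesis cX : compact [set: X].

Lemma continuous_compact_bounded (f : X -> R) : continuous f ->
  exists2 M : R, 0 < M & forall x, `|f x| <= M.
Proof.
move=> cf.
have [M fM] : exists M : R, forall x, [set: X] x -> `|f x| <= M.
  apply: (@compact_ideal _ [set: X] (fun Z => exists M : R, forall x, Z x -> `|f x| <= M)) => //.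
  - by exists 0.
  - move=> A B [M AM] [N BN]; exists (Num.max M N) => x [/AM|/BN] h.
      by rewrite le_max h.
    by rewrite le_max h orbT.
  - by move=> A B AB [M BM]; exists M => x /AB /BM.
  - move=> x _; exists [set y | `|f y| < `|f x| + 1].
      apply: open_nbhs_nbhs; split; last by rewrite /= ltrDl.
      by apply: open_lt_continuous; cts.
    by exists (`|f x| + 1) => y /= /ltW.
exists (`|M| + 1) => [|x]; first by rewrite ltr_wpDl.
by rewrite (le_trans (fM x I))// (le_trans (ler_norm M))// lerDl.
Qed.

Lemma continuous_integrable (mu : probability (borel X) R) (f : X -> R) :
  continuous f -> mu.-integrable [set: borel X] (EFin \o f).
Proof.
move=> cf; have [M M0 fM] := continuous_compact_bounded cf.
apply: measurable_bounded_integrable => //.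
- by rewrite [ltLHS](@probability_setT _ _ _ mu) ltry.
- exact: continuous_borel_measurable.
- exists M; split; first exact: num_real.
  by move=> N MN x _ /=; rewrite (le_trans (fM x))// ltW.
Qed.

Lemma integral_state (mu : probability (borel X) R) :
  state (fun f : X -> R => \int[mu]_(x in [set: borel X]) f x).
Proof.
split.
- move=> a f g cf cg; rewrite RintegralD//; last first.
  + exact: continuous_integrable.
  + by apply: continuous_integrable; cts.
  + by rewrite RintegralZl//; exact: continuous_integrable.
- by move=> f _ f0; apply: Rintegral_ge0.
- rewrite Rintegral_cst// mul1r.
  by transitivity (fine (1%E : \bar R)) => //; congr fine; exact: probability_setT.
Qed.

Lemma integral_homeo_invariant (mu : probability (borel X) R) (h : X -> X) (f : X -> R) :
  continuous h -> continuous f ->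
  (forall A : set (borel X), measurable A -> mu (h @^-1` A) = mu A) ->
  \int[mu]_(x in [set: borel X]) f (h x) = \int[mu]_(x in [set: borel X]) f x.
Proof.
move=> ch cf mh; rewrite /Rintegral; congr fine.
have mph : measurable_fun [set: borel X] (h : borel X -> borel X).
  apply: (@measurability _ _ (borel X) (borel X) _ _ (@open X)) => // _ [U oU <-].
  by rewrite setTI; apply: open_borel; move/continuousP : ch; exact.
transitivity (\int[pushforward mu (h : borel X -> borel X)]_(x in [set: borel X]) (f x)%:E)%E.
  rewrite integral_pushforward//.
  - by apply/measurable_EFinP; exact: continuous_borel_measurable.
  - apply: (continuous_integrable mu (f := f \o h)).
    by move=> x; apply: continuous_comp; [exact: ch|exact: cf].
by apply: eq_measure_integral => A mA _; exact: mh.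
Qed.

End BorelMeasures.

Section RieszRepresentation.
Variables (R : realType) (X : ptopologicalType) (p : (X -> R) -> R).
Hypotheses (sp : state p) (cX : compact [set: X]) (perf : perfect_space R X).

Lemma riesz_measure : exists mu : probability (borel X) R,
  forall A : set (borel X), mu A = outer_content p A.
Proof.
have o0 : outer_content p set0 = 0%E.
  by rewrite outer_content_open ?inner_content0//; exact: open0.
pose mu : {outer_measure set X -> \bar R} := HB.pack (outer_content p)
  (isOuterMeasure.Build R X (outer_content p) o0 (outer_content_ge0 sp)
     (@outer_content_le _ _ p) (outer_content_sigma_subadditive sp cX perf)).
have cara : (measurable : set (set (borel X))) `<=`
    (measurable : set (set (caratheodory_type mu))).
  apply: smallest_sub; first exact: sigma_algebra_measurable.
  move=> U oU; apply: le_caratheodory_measurable => A.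
  exact: outer_content_additive_open.
have sadd : semi_sigma_additive (outer_content p : set (borel X) -> \bar R).
  move=> F mF tF mUF.
  apply: (@caratheodory_measure_sigma_additive _ _ mu F) => //.
    by move=> n; apply: cara; exact: mF.
  exact: cara.
have [nu nuE] : exists nu : {measure set (borel X) -> \bar R},
    forall A, nu A = outer_content p A.
  pose nu : {measure set (borel X) -> \bar R} :=
    HB.pack (outer_content p : set (borel X) -> \bar R)
      (isMeasure.Build _ (borel X) R (outer_content p : set (borel X) -> \bar R)
         o0 (outer_content_ge0 sp) sadd).
  by exists nu.
have nuT : nu [set: borel X] = 1%E.
  rewrite nuE (outer_content_open _ (openT : open [set: X])).
  exact: inner_contentT.
(* The total mass is 1, so normalizing returns [nu] itself and only supplies the [probability]
   structure; the Dirac measure is the default for mass 0 or infinity. *)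
exists (mnormalize nu (dirac point : probability (borel X) R)) => A.
rewrite -nuE /= /mnormalize nuT ifF ?invr1 ?mule1//.
by apply/negbTE; rewrite negb_or onee_eq0.
Qed.

(* Layer-cake: [min f (n/N)] increases by at most [1/N] times the indicator of
   [f > n/N] when [n] increases by one. *)
Lemma state_le_integral (mu : probability (borel X) R) (f : X -> R) :
  (forall A : set (borel X), mu A = outer_content p A) ->
  continuous f -> (forall x, 0 <= f x <= 1) ->
  p f <= \int[mu]_(x in [set: borel X]) f x.
Proof.
move=> muE cf f01; apply/ler_addgt0Pr => e e0.
pose N := (Num.truncn e^-1).+1; pose d : R := N%:R^-1.
have N0 : 0 < N%:R :> R by rewrite ltr0n.
have d0 : 0 < d by rewrite invr_gt0.
have de : d <= e.
  by rewrite -[e]invrK lef_pV2 ?posrE ?invr_gt0// ltW// truncnS_gt.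
pose A n : set X := [set x | n%:R * d < f x].
have mA n : measurable (A n : set (borel X)).
  by apply: open_borel; exact: open_gt_continuous.
pose s n (x : borel X) : R := \sum_(i < n) d * \1_(A i) x.
have sS n x : s n.+1 x = s n x + d * \1_(A n) x by rewrite /s big_ord_recr.
have s_ge0 n x : 0 <= s n x.
  by apply: sumr_ge0 => i _; rewrite mulr_ge0// ltW.
have s_le n x : s n x <= Num.min (f x + d) (n%:R * d).
  elim: n => [|n IH].
    by rewrite /s big_ord0 mul0r le_min lexx andbT addr_ge0 ?(ltW d0)//; case/andP: (f01 x).
  rewrite sS indicE; have [|] := boolP (x \in A n).
    rewrite inE /A/= => nf; rewrite mulr1; move: IH; rewrite !le_min -natr1 => /andP[_ h].
    by apply/andP; split; lra.
  move=> _; rewrite mulr0 addr0; move: IH; rewrite !le_min -natr1 => /andP[h1 h2].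
  by apply/andP; split; lra.
have ms n : measurable_fun [set: borel X] (s n).
  elim: n => [|n IH].
    by rewrite (_ : s 0%N = fun=> 0)//; apply/funext => x; rewrite /s big_ord0.
  rewrite (_ : s n.+1 = fun x => s n x + d * \1_(A n) x); last exact/funext.
  by apply: measurable_funD => //; apply: measurable_funM => //; exact: measurable_indic.
have is_ n : mu.-integrable [set: borel X] (EFin \o s n).
  apply: measurable_bounded_integrable => //.
  - by rewrite [ltLHS](@probability_setT _ _ _ mu) ltry.
  - exists (n%:R * d); split; first exact: num_real.
    move=> M dM x _ /=; rewrite ger0_norm//; apply: le_trans (ltW dM).
    by have := s_le n x; rewrite le_min => /andP[].
have iA n : mu.-integrable [set: borel X] (EFin \o (fun x => \1_(A n) x : R)).
  apply: measurable_bounded_integrable => //.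
  - by rewrite [ltLHS](@probability_setT _ _ _ mu) ltry.
  - exact: measurable_indic.
  - exists 1; split; first exact: num_real.
    by move=> M M1 x _ /=; rewrite ger0_norm// (le_trans _ (ltW M1))// indicE; case: (_ \in _).
have claim n : p (fun x => Num.min (f x) (n%:R * d)) <= \int[mu]_(x in [set: borel X]) s n x.
  elim: n => [|n IH].
    have -> : (fun x => Num.min (f x) (0%:R * d)) = fun=> 0.
      by apply/funext => x; rewrite mul0r; apply/min_idPr; case/andP: (f01 x).
    by rewrite (state0 sp) Rintegral_ge0.
  rewrite (_ : s n.+1 = fun x => s n x + d * \1_(A n) x); last exact/funext.
  have idA : mu.-integrable [set: borel X] (EFin \o (fun x => d * \1_(A n) x : R)).
    exact: (integrableZl measurableT d (iA n)).
  rewrite RintegralD// RintegralZl//.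
  (* The n-th slice of [f] between heights [n * d] and [(n + 1) * d], rescaled to [0, 1]. It
     vanishes off [A n], so [p g] is at most the content of [A n]. *)
  pose g x := Num.min 1 (N%:R * Num.max 0 (f x - n%:R * d)).
  have cg : continuous g by rewrite /g; cts.
  have dN : d * N%:R = 1 by rewrite mulVf// gt_eqF.
  have -> : (fun x => Num.min (f x) (n.+1%:R * d)) =
      fun x => Num.min (f x) (n%:R * d) + d * g x.
    apply/funext => x; rewrite /g minr_pMr ?ltW// mulr1 mulrA dN mul1r -natr1 mulrDl mul1r.
    rewrite !minEle !maxEle; case: (leP 0 (f x - _)) => h0;
      case: (leP (f x) (n%:R * d)) => h1; case: (leP (f x) (_ + d)) => h2;
      case: (leP d _) => h3; lra.
  rewrite (stateD sp)//; [|cts..].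
  apply: lerD => //; rewrite (stateZ sp)// ler_pM2l//.
  have -> : \int[mu]_(x in [set: borel X]) (\1_(A n) x : R) = fine (mu (A n)).
    by rewrite /Rintegral integral_indic// setIT.
  have oA : open (A n) by exact: open_gt_continuous.
  rewrite muE outer_content_open// -lee_fin fineK ?inner_content_fin_num//.
  apply: subordinate_le_content; split => // [x|x nAx].
    by rewrite le_min ler01 ge_min lexx/= mulr_ge0// le_max lexx.
  rewrite /g (max_idPl _) ?mulr0; first by apply/min_idPr.
  by move/negP: nAx; rewrite /A/= -leNgt subr_le0.
have -> : f = fun x => Num.min (f x) (N%:R * d).
  apply/funext => x; rewrite mulfV ?gt_eqF//; apply/esym/min_idPl.
  by case/andP: (f01 x).
apply: le_trans (claim N) _.
apply: le_trans (_ : \int[mu]_(x in [set: borel X]) (f x + d) <= _).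
  apply: le_Rintegral => //.
    by apply: (@continuous_integrable _ _ cX mu (fun x => f x + d)); cts.
  by move=> x _; have := s_le N x; rewrite le_min => /andP[].
have sI := integral_state cX mu.
have := stateD sI cf (cts_cst d) => /= ->.
rewrite (state_cst sI) lerD//.
rewrite le_eqVlt; apply/orP; left; apply/eqP; congr Rintegral.
by apply/funext => x; rewrite mulfV ?gt_eqF//; apply/esym/min_idPl; case/andP: (f01 x).
Qed.

(** [state_le_integral] is one inequality for [0, 1]-valued functions. An affine rescaling extends
    it to all of C(X), and applying it to [f] and to [- f] gives equality. *)
Theorem riesz_representation : exists mu : probability (borel X) R,
  (forall A : set (borel X), mu A = outer_content p A) /\
  forall f, continuous f -> \int[mu]_(x in [set: borel X]) f x = p f.
Proof.
have [mu muE] := riesz_measure; exists mu; split => // f cf.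
have sI := integral_state cX mu; set I := (fun f : X -> R => _) in sI.
rewrite -/(I f).
have le_pI g : continuous g -> p g <= I g.
  move=> cg; have [M M0 gM] := continuous_compact_bounded cX cg.
  pose h x := (2 * M)^-1 * (g x + M).
  have ch : continuous h by rewrite /h; cts.
  have M20 : 0 < 2 * M by rewrite mulr_gt0.
  have h01 x : 0 <= h x <= 1.
    have := gM x; rewrite ler_norml => /andP[g1 g2].
    by rewrite /h mulr_ge0 ?invr_ge0 ?(ltW M20)//= ?ler_pdivrMl// ; lra.
  have := state_le_integral muE ch h01; rewrite -/(I h) /h.
  rewrite (stateZ sp) ?(stateZ sI); [|cts..].
  rewrite (stateD sp) ?(stateD sI); [|cts..].
  by rewrite (state_cst sp) (state_cst sI) ler_pM2l ?invr_gt0// lerD2r.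
apply/eqP; rewrite eq_le le_pI// andbT -lerN2 -(stateN sp)// -(stateN sI)//.
by apply: le_pI; cts.
Qed.

End RieszRepresentation.

(** ** Invariant states and invariant measures *)

Section InvariantStates.
Variables (R : realType) (G : groupType) (X : ptopologicalType).
Variable alpha : continuous_action G X.

Definition invariant_state (p : (X -> R) -> R) : Prop :=
  state p /\ forall g f, continuous f -> p (fun x => f (alpha g x)) = p f.

(* Avoids bundling continuity proofs in arguments; junk value 0 at
   discontinuous functions. *)
Definition ev (q : functionals R X) (f : X -> R) : R :=
  if pselect (continuous f) is left cf then q (mkcts cf : continuousType X R) else 0.

Lemma evE (q : functionals R X) (f : continuousType X R) : ev q f = q f.
Proof.
rewrite /ev; case: pselect => [cf|[]]; last exact: cts_fun.
by congr q; apply/continuousEP.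
Qed.

Lemma evP (q : functionals R X) (f : X -> R) : continuous f ->
  exists k : continuousType X R, forall q, ev q f = q k.
Proof. by move=> cf; exists (mkcts cf) => r; rewrite -evE. Qed.

Lemma eq_invariant_state (p p' : (X -> R) -> R) :
  (forall f, continuous f -> p f = p' f) -> invariant_state p -> invariant_state p'.
Proof.
move=> pp' [sp ip]; split; first split.
- by move=> a f g cf cg; rewrite -!pp' ?(stateP sp)//; cts.
- by move=> f cf f0; rewrite -pp'//; exact: (state_ge0 sp).
- by rewrite -pp' ?(state1 sp)//; exact: cts_cst.
- move=> g f cf; rewrite -!pp' ?ip// => x.
  by apply: continuous_comp; [exact: act_continuous|exact: cf].
Qed.

Lemma continuous_act_comp g (f : X -> R) : continuous f ->
  continuous (fun x => f (alpha g x)).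
Proof. by move=> cf x; apply: continuous_comp; [exact: act_continuous|exact: cf]. Qed.

Lemma actK g : cancel (alpha (g^-1)%g) (alpha g).
Proof. by move=> x; rewrite -actM mulgV act1. Qed.

Lemma outer_content_act_le p g A : invariant_state p ->
  (outer_content p (alpha g @^-1` A) <= outer_content p A)%E.
Proof.
move=> [sp ip]; apply: le_ereal_inf_tmp => _ [U [oU AU] <-].
apply: ge_ereal_inf; exists (inner_content p (alpha g @^-1` U)).
  exists (alpha g @^-1` U) => //; split; last by move=> x; exact: AU.
  by move/continuousP : (@act_continuous _ _ alpha g); exact.
apply: ge_ereal_sup => _ [f [cf f01 f0] <-].
rewrite -(ip (g^-1)%g f cf); apply: subordinate_le_content; split.
- exact: continuous_act_comp.
- by move=> x; exact: f01.
- by move=> x nUx; apply: f0; rewrite /= actK.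
Qed.

Lemma outer_content_act p g A : invariant_state p ->
  outer_content p (alpha g @^-1` A) = outer_content p A.
Proof.
move=> ip; apply/eqP; rewrite eq_le outer_content_act_le//=.
have := outer_content_act_le (g^-1)%g (alpha g @^-1` A) ip.
rewrite (_ : _ @^-1` (_ @^-1` A) = A)//.
by apply/seteqP; split => x /=; rewrite actK.
Qed.

Hypotheses (cX : compact [set: X]) (perf : perfect_space R X).

(** Outer regularity is built into the outer content. Inner regularity at [A] is outer regularity at
    the complement of [A], since closed subsets of [X] are compact. *)
Lemma outer_content_regular p (mu : probability (borel X) R) : state p ->
  (forall A : set (borel X), mu A = outer_content p A) -> regular_measure mu.
Proof.
move=> sp muE.
have outer A : mu A = ereal_inf [set mu U | U in [set U : set X | open U /\ A `<=` U]].
  rewrite muE; congr ereal_inf; apply/seteqP; split => _ [U [oU AU] <-]; exists U => //.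
    by rewrite muE outer_content_open.
  by rewrite muE outer_content_open.
move=> A mA; split; first exact: outer.
have mCK (B : set (borel X)) : measurable B -> mu (~` B) = (1 - mu B)%E.
  by move=> mB; rewrite -probability_setC.
apply/eqP; rewrite eq_le; apply/andP; split; last first.
  apply: ge_ereal_sup => _ [K [cK KA] <-]; rewrite !muE; exact: outer_content_le.
apply/lee_addgt0Pr => e e0.
have [U [oU AU Ule]] := outer_content_adherent sp (~` A) e0.
have mU : measurable (U : set (borel X)) by exact: open_borel.
apply: le_trans (_ : mu (~` U) + e%:E <= _)%E; last first.
  rewrite leeD2r//; apply: ereal_sup_ubound; exists (~` U) => //; split.
    by apply: (subclosed_compact _ cX) => //; exact: open_closedC.
  by move=> x nUx; apply: contrapT => /AU.
have -> : mu A = (1 - mu (~` A))%E.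
  by rewrite -mCK ?setCK//; exact: measurableC.
rewrite (mCK U mU).
move: Ule; rewrite -outer_content_open// -!muE.
have fin (B : set (borel X)) : mu B \is a fin_num.
  by rewrite muE; exact: outer_content_fin_num.
rewrite -(fineK (fin (~` A))) -(fineK (fin U)) => Ule.
change ((1 - fine (mu (~` A)))%:E <= (1 - fine (mu U) + e)%:E)%E.
by move: Ule; rewrite -EFinD !lee_fin; lra.
Qed.

(** Trades measures for conditions on the coordinates of [q]; the converse direction is the Riesz
    theorem, with invariance and regularity read off the outer content. *)
Lemma M_GP (q : functionals R X) : M_G R alpha q <-> invariant_state (ev q).
Proof.
split=> [[mu [_ imu] <-]|[sq iq]].
  apply: (@eq_invariant_state (fun f => \int[mu]_(x in [set: borel X]) f x)).
    by move=> f cf; rewrite /ev; case: pselect.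
  split; first exact: integral_state.
  move=> g f cf; apply: (@integral_homeo_invariant _ _ cX mu (alpha g)) => //.
  - exact: act_continuous.
  - exact: imu.
have [mu [muE muI]] := riesz_representation sq cX perf.
exists mu.
  split; first exact: (outer_content_regular sq).
  by move=> g A mA; rewrite !muE; exact: outer_content_act.
by apply/funext => f; rewrite -[RHS]evE; exact: (muI _ (@cts_fun _ _ f)).
Qed.

Lemma E_G_invariant_state q : E_G R alpha q -> invariant_state (ev q).
Proof. by case=> /M_GP. Qed.

(** Extremality restated for functionals on bare functions, where equality can be claimed at
    continuous functions only. This is the hypothesis that [mean_ergodic] takes. *)
Lemma E_G_extreme (q : functionals R X) (p1 p2 : (X -> R) -> R) (t : R) :
  E_G R alpha q -> invariant_state p1 -> invariant_state p2 -> 0 < t < 1 ->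
  (forall f, continuous f -> ev q f = t * p1 f + (1 - t) * p2 f) ->
  forall f, continuous f -> p1 f = ev q f.
Proof.
move=> [Mq ext] i1 i2 t01 qE.
pose r (p : (X -> R) -> R) : functionals R X := fun f => p f.
have evr p f : continuous f -> ev (r p) f = p f.
  by move=> cf; rewrite /ev; case: pselect.
have Mr p : invariant_state p -> M_G R alpha (r p).
  by move=> ip; apply/M_GP; apply: eq_invariant_state ip => f /evr.
have [] := ext (r p1) (r p2) t (Mr _ i1) (Mr _ i2) t01.
  by apply/funext => f; rewrite -evE qE//; exact: cts_fun.
by move=> <- _ f cf; rewrite evr.
Qed.

Lemma ev_continuous f : continuous f -> continuous (ev ^~ f : functionals R X -> R).
Proof.
move=> cf; have [k kE] := evP (fun=> 0) cf.
rewrite (_ : ev ^~ f = fun q => q k); last exact/funext.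
exact: proj_continuous.
Qed.

(** Banach-Alaoglu in coordinates: [M_G] lies in a product of segments, and it is closed because the
    conditions defining an invariant state are equalities and inequalities between continuous
    coordinates. *)
Lemma M_G_compact : compact (M_G R alpha).
Proof.
have /choice[B BP] (k : continuousType X R) : exists M : R, forall x, `|k x| <= M.
  have [M _ kM] := continuous_compact_bounded cX (@cts_fun _ _ k).
  by exists M.
pose K : set (functionals R X) := [set q | forall k, `[- B k, B k]%classic (q k)].
have cK : compact K.
  by apply: (@tychonoff _ (fun=> R) (fun k => `[- B k, B k]%classic)) => k; exact: segment_compact.
apply: subclosed_compact cK _; last first.
  move=> q /M_GP[sq _] k; rewrite /= in_itv/= -ler_norml -evE.
  exact: (state_bounded sq (@cts_fun _ _ k)).
have closureM (F : functionals R X -> R) : continuous F -> (forall q, M_G R alpha q -> 0 <= F q) ->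
    forall q, closure (M_G R alpha) q -> 0 <= F q :> R.
  move=> cF MF; have clF : closed [set q | 0 <= F q].
    by apply: (@preimage_closed _ _ F [set y | 0 <= y]) => //; exact: closed_ge.
  move=> q clq; suff : closure [set q | 0 <= F q] q by rewrite -(closure_id _).1.
  by apply: closureS clq => r /MF.
have closureM0 (F : functionals R X -> R) : continuous F -> (forall q, M_G R alpha q -> F q = 0) ->
    forall q, closure (M_G R alpha) q -> F q = 0 :> R.
  move=> cF MF q clq; apply/eqP; rewrite eq_le -oppr_ge0; apply/andP; split.
    apply: (closureM (fun q => - F q)) clq; first by cts.
    by move=> r Mr; rewrite MF ?oppr0.
  by apply: closureM clq => // r Mr; rewrite MF.
apply/closure_id/seteqP; split; first exact: subset_closure.
move=> q clq; apply/M_GP; split; first split.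
- move=> a f g cf cg; apply/eqP; rewrite -subr_eq0; apply/eqP.
  apply: (closureM0 (fun q => ev q (fun x => a * f x + g x) - (a * ev q f + ev q g))) => //.
    have caf : continuous (fun x => a * f x + g x) by cts.
    have := ev_continuous caf; have := ev_continuous cf; have := ev_continuous cg.
    by move=> h1 h2 h3; cts.
  by move=> r /M_GP[sr _]; rewrite (stateP sr)// subrr.
- move=> f cf f0; apply: (closureM (ev ^~ f)) => //; first exact: ev_continuous.
  by move=> r /M_GP[sr _]; exact: (state_ge0 sr).
- apply/eqP; rewrite -subr_eq0; apply/eqP.
  apply: (closureM0 (fun q => ev q (fun=> 1) - 1)) => //.
    by have h1 := ev_continuous (cts_cst 1); cts.
  by move=> r /M_GP[sr _]; rewrite (state1 sr) subrr.
- move=> g f cf; apply/eqP; rewrite -subr_eq0; apply/eqP.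
  apply: (closureM0 (fun q => ev q (fun x => f (alpha g x)) - ev q f)) => //.
    have h1 := ev_continuous cf; have h2 := ev_continuous (@continuous_act_comp g _ cf).
    by cts.
  by move=> r /M_GP[_ ir]; rewrite ir// subrr.
Qed.

End InvariantStates.

(** ** Bauer's maximum principle *)

Section BauerMaximumPrinciple.
Variables (R : realType) (I : eqType) (K : set {ptws I -> R}).
Hypothesis cK : compact K.

Definition face (C : set {ptws I -> R}) : Prop := forall (p q r : {ptws I -> R}) (t : R),
  K p -> K q -> K r -> 0 < t < 1 -> p = (fun i => t * q i + (1 - t) * r i) ->
  C p -> C q /\ C r.

Lemma closed_level (i : I) (m : R) : closed [set p : {ptws I -> R} | p i = m].
Proof.
apply: (@preimage_closed _ _ (fun p : {ptws I -> R} => p i) [set m]).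
  by move=> p _; exact: (@proj_continuous I (fun=> R) i).
exact: closed_eq.
Qed.

Lemma level_face (C : set {ptws I -> R}) (i : I) (m : R) : face C ->
  (forall p, K p -> C p -> p i <= m) -> face (C `&` [set p | p i = m]).
Proof.
move=> fC Cm p q r t Kp Kq Kr t01 pE [Cp pm].
have [Cq Cr] := fC p q r t Kp Kq Kr t01 pE Cp.
have := Cm q Kq Cq; have := Cm r Kr Cr; move: t01 pm => /andP[t0 t1].
rewrite /= pE => pm rm qm.
suff qE : q i = m.
  split; split => //=; rewrite qE in pm.
  have : (1 - t) * (r i - m) = 0 by rewrite -[in RHS](subrr m) -{2}pm; ring.
  by move/eqP; rewrite mulf_eq0 subr_eq0 gt_eqF//= subr_eq0 => /eqP.
apply/eqP; rewrite eq_le qm/= -subr_le0 -(pmulr_rle0 _ t0).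
have : (1 - t) * (r i - m) <= 0 by rewrite pmulr_rle0 ?subr_gt0 ?subr_le0.
lra.
Qed.

(** Take a minimal closed face of [K] inside the face where the coordinate [i0] is maximal. Each
    coordinate is constant on it, since otherwise the level set of its maximum would be a smaller
    face. So it is a single point, which is extreme and attains the maximum. *)
Lemma ler_extreme_points (i0 : I) (c : R) :
  (forall p, extreme_points K p -> p i0 <= c) -> forall p, K p -> p i0 <= c.
Proof.
move=> Kc p0 Kp0.
have cproj (i : I) : continuous (fun p : {ptws I -> R} => p i).
  exact: (@proj_continuous I (fun=> R) i).
have maxE (C : set {ptws I -> R}) i : closed C -> (K `&` C) !=set0 ->
    exists p, [/\ K p, C p & forall q, K q -> C q -> q i <= p i].
  move=> clC C0; have [|p] := compact_EVT_max C0 (compact_closedI cK clC) (f := fun p : {ptws I -> R} => p i).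
    by apply: continuous_subspaceT => x; exact: cproj.
  rewrite inE => -[Kp Cp] pmax; exists p; split => // q Kq Cq.
  by apply: pmax; rewrite inE.
have [m [Km _ mmax]] := maxE setT i0 closedT (ex_intro _ p0 (conj Kp0 Logic.I)).
apply: le_trans (mmax _ Kp0 Logic.I) _.
pose C0 := [set p : {ptws I -> R} | p i0 = m i0].
have clC0 : closed C0 by exact: closed_level.
have fC0 : face C0.
  by rewrite -(setTI C0); apply: level_face => // p Kp _; exact: mmax.
(* Faces are encoded by their complements: [Zorn_bigcup] works with unions of increasing chains, and
   a maximal [A] gives a minimal face. *)
pose good (A : set {ptws I -> R}) := [/\ closed (C0 `&` ~` A),
  (K `&` (C0 `&` ~` A)) !=set0 & face (C0 `&` ~` A)].
have [A [[clA A0 fA] Amax]] : exists A, good A /\ forall B, A `<` B -> ~ good B.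
  apply: Zorn_bigcup => F Fgood Ftot.
  have capE : C0 `&` ~` (\bigcup_(A in F) A) =
      C0 `&` (\bigcap_(A in F) (C0 `&` ~` A)).
    apply/seteqP; split=> p [C0p pF]; split => //.
      by move=> A FA; split => // Ap; apply: pF; exists A.
    by move=> [A FA Ap]; have [_] := pF A FA.
  rewrite /good capE; split.
  - by apply: closedI => //; apply: closed_bigI => A /Fgood[].
  - apply: contrapT => empty.
    (* If the chain had empty intersection, compactness would let one complement cover all of [K]
       and [C0]. The alternative [set0] serves the points outside [C0] and the empty chain. *)
    have [A FA KA] : exists2 A, F A \/ A = set0 & K `&` K `&` C0 `<=` A.
      apply: (@compact_ideal _ K (fun Z => exists2 A, F A \/ A = set0 & Z `&` K `&` C0 `<=` A)) => //.
      + by exists set0; [right|rewrite !set0I].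
      + move=> Y Z [A FA YA] [B FB ZB].
        have [AB|BA] : A `<=` B \/ B `<=` A.
        * case: FA FB => [FA|->] [FB|->]; [exact: Ftot|right|left|left] => //; exact: sub0set.
        * exists B => //; rewrite -setIA setIUl subUset !setIA; split => //.
          exact: subset_trans AB.
        * exists A => //; rewrite -setIA setIUl subUset !setIA; split => //.
          exact: subset_trans BA.
      + move=> Y Z YZ [A FA ZA]; exists A => //; apply: subset_trans ZA.
        by do 2 apply: setSI.
      + move=> x Kx; have [C0x|nC0x] := pselect (C0 x).
          have [A FA Ax] : exists2 A, F A & A x.
            apply: contrapT => nA; apply: empty; exists x; split => //; split => // A FA.
            by split => // Ax; apply: nA; exists A.
          exists (~` (C0 `&` ~` A)).
            apply: open_nbhs_nbhs; split; last by move=> [].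
            by apply: closed_openC; case: (Fgood A FA).
          exists A; first by left.
          by move=> y [[nC _] C0y]; apply: contrapT => nAy; exact: nC.
        exists (~` C0); first by apply: open_nbhs_nbhs; split => //; exact: closed_openC.
        by exists set0; [right|move=> y [[]]].
    case: FA => [FA|A0]; last by have := KA m (conj (conj Km Km) erefl); rewrite A0.
    have [_ [x [Kx [C0x nAx]]] _] := Fgood A FA.
    by apply: nAx; apply: KA.
  - move=> p q r t Kp Kq Kr t01 pE [C0p pF].
    have [C0q C0r] := fC0 p q r t Kp Kq Kr t01 pE C0p.
    split; split => // A FA; have [_ _ fA] := Fgood A FA.
      by have [] := fA p q r t Kp Kq Kr t01 pE (pF A FA).
    by have [] := fA p q r t Kp Kq Kr t01 pE (pF A FA).
set C := C0 `&` ~` A in clA A0 fA.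
have cst_on i p q : K p -> C p -> K q -> C q -> p i = q i.
  have [s [Ks Cs smax]] := maxE C i clA A0.
  suff Clevel r : K r -> C r -> r i = s i.
    by move=> Kp Cp Kq Cq; rewrite !Clevel.
  pose C' := C `&` [set p | p i = s i].
  have C'E : C0 `&` ~` ~` C' = C'.
    by rewrite setCK; apply/setIidPr => x [[]].
  have gC' : good (~` C').
    rewrite /good C'E; split.
    - by apply: closedI => //; exact: closed_level.
    - by exists s.
    - exact: level_face.
  move=> Kr Cr; apply: contrapT => ri; apply: (Amax (~` C')) gC'.
  split.
    by move=> x Ax [[_ nAx] _].
  move=> CA; have [_ nAr] := Cr; apply: nAr; apply: CA => -[_].
  exact: ri.
have [p [Kp Cp]] := A0.
have pm : p i0 = m i0 by case: Cp.
rewrite -pm; apply: Kc; split => // q r t Kq Kr t01 pE.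
have [Cq Cr] := fA p q r t Kp Kq Kr t01 pE Cp.
by split; apply/funext => i; exact: cst_on.
Qed.

End BauerMaximumPrinciple.

(** ** The Hahn-Banach theorem *)

Section HahnBanach.
Variables (R : realType) (V : lmodType R) (W : set V).
Hypotheses (WD : forall x y, W x -> W y -> W (x + y))
  (WZ : forall a x, W x -> W (a *: x)).

(** Everything is relative to a subspace [W], later the bounded functions on [X]. Homogeneity is
    asked as an inequality, which is easier to check for infima; [sublinearZ] upgrades it. *)
Definition sublinear (q : V -> R) : Prop :=
  (forall x y, W x -> W y -> q (x + y) <= q x + q y) /\
  (forall a x, 0 < a -> W x -> q (a *: x) <= a * q x).

Lemma sublinearZ q a x : sublinear q -> 0 < a -> W x -> q (a *: x) = a * q x.
Proof.
move=> [_ qZ] a0 Wx; apply/eqP; rewrite eq_le qZ//=.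
have a0' : 0 < a^-1 by rewrite invr_gt0.
have := qZ a^-1 (a *: x) a0' (WZ a Wx).
by rewrite scalerA mulVf ?gt_eqF// scale1r ler_pdivlMl.
Qed.

Lemma sublinear_ge q x y : sublinear q -> W x -> W y -> q y - q (- x) <= q (x + y).
Proof.
move=> [qD _] Wx Wy; rewrite lerBlDr.
have WNx : W (- x) by rewrite -scaleN1r; exact: WZ.
have := qD _ _ (WD Wx Wy) WNx.
by rewrite addrAC subrr add0r.
Qed.

Lemma sublinear0 q x : sublinear q -> W x -> q 0 = 0.
Proof.
move=> sq Wx; have W0 : W 0 by rewrite -(scale0r x); exact: WZ.
have := sublinearZ sq (ltr0Sn R 1) W0.
by rewrite scaler0; lra.
Qed.

(* A minimal sublinear functional is linear: it cannot be lowered in any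
   direction [y]. *)
Lemma hahn_banach (P : V -> R) : sublinear P ->
  exists L : V -> R, [/\ forall x y, W x -> W y -> L (x + y) = L x + L y,
    forall a x, W x -> L (a *: x) = a * L x & forall x, W x -> L x <= P x].
Proof.
move=> sP.
(* With the values off [W] pinned to 0, the order can compare functions at every point of [V] and is
   antisymmetric. The order [le] is reversed, so Zorn's maximal element is a minimal functional. *)
pose ok (q : V -> R) := [/\ sublinear q, forall x, ~ W x -> q x = 0 &
  forall x, W x -> q x <= P x].
pose T := {q : V -> R | ok q}.
pose le (s t : T) := `[< forall x, sval t x <= sval s x >].
have lbP q x : ok q -> W x -> - P (- x) <= q x.
  move=> [sq _ qP] Wx; have WNx : W (- x) by rewrite -scaleN1r; exact: WZ.
  have [qD _] := sq; have := qD _ _ Wx WNx; have := qP _ WNx.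
  by rewrite subrr (sublinear0 sq Wx); lra.
have extend q : sublinear q -> (forall x, W x -> q x <= P x) ->
    ok (fun x => if x \in W then q x else 0).
  move=> [qD qZ] qP; split; first split.
  - move=> x y Wx Wy.
    by rewrite !mem_set//; [exact: qD|exact: WD].
  - move=> a x a0 Wx; rewrite !mem_set//; [exact: qZ|exact: WZ].
  - by move=> x nWx; rewrite memNset.
  - by move=> x Wx; rewrite mem_set// qP.
have [|||A Atot|[q okq] qmin] := @Zorn T le.
- by move=> t; apply/asboolP.
- move=> r s t /asboolP rs /asboolP st; apply/asboolP => x.
  exact: le_trans (st x) (rs x).
- move=> [s oks] [t okt] /asboolP st /asboolP ts; apply/eq_exist/funext => x.
  by apply/eqP; rewrite eq_le st ts.
- have [[s0 As0]|A0] := pselect (A !=set0); last first.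
    exists (exist _ _ (extend P sP (fun x _ => lexx _))) => s As.
    by case: A0; exists s.
  pose S z := [set sval s z | s in A].
  have S0 z : S z !=set0 by exists (sval s0 z); exists s0.
  have Slb z : W z -> lbound (S z) (- P (- z)).
    by move=> Wz _ [s As <-]; exact: lbP (svalP s) Wz.
  have inf_le z s : W z -> A s -> inf (S z) <= sval s z.
    move=> Wz As; apply: ge_inf; last by exists s.
    by exists (- P (- z)); exact: Slb.
  have sinf : sublinear (fun z => inf (S z)).
    split=> [u v Wu Wv|a u a0 Wu].
      rewrite -lerBlDr; apply: lb_le_inf => // _ [s As <-].
      rewrite lerBlDr -lerBlDl; apply: lb_le_inf => // _ [t At <-].
      rewrite lerBlDl; have [sq tq] := (svalP s, svalP t).
      have [/asboolP st|/asboolP ts] := Atot s t As At.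
        apply: le_trans (inf_le _ t (WD Wu Wv) At) _.
        by case: tq => -[tD _] _ _; apply: le_trans (tD _ _ Wu Wv) _; rewrite lerD2r st.
      apply: le_trans (inf_le _ s (WD Wu Wv) As) _.
      by case: sq => -[sD _] _ _; apply: le_trans (sD _ _ Wu Wv) _; rewrite lerD2l ts.
    rewrite -ler_pdivrMl//; apply: lb_le_inf => // _ [s As <-].
    rewrite ler_pdivrMl//; apply: le_trans (inf_le _ s (WZ a Wu) As) _.
    by case: (svalP s) => -[_ sZ] _ _; exact: sZ.
  have infP z : W z -> inf (S z) <= P z.
    by move=> Wz; apply: le_trans (inf_le z s0 Wz As0) _; case: (svalP s0) => _ _; exact.
  exists (exist _ _ (extend _ sinf infP)) => s As; apply/asboolP => x /=.
  case: ifPn => [/set_mem Wx|/negP nWx]; first exact: inf_le.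
  by case: (svalP s) => _ -> // Wx; apply: nWx; rewrite mem_set.
have [sq q0 qP] := okq; have [qD qZ] := sq.
have qadd x y : W x -> W y -> q (x + y) = q x + q y.
  move=> Wx Wy; apply/eqP; rewrite eq_le qD//=.
  (* The infimum [qy] is sublinear and below [q] (take t = 0), so it equals [q] by minimality; t = 1
     then gives q(x) + q(y) <= q(x + y). *)
  pose S z := [set q (z + t *: y) - t * q y | t in [set t : R | 0 <= t]].
  pose qy z := inf (S z).
  have Slb z : W z -> lbound (S z) (- q (- z)).
    move=> Wz _ [t /= t0 <-]; have WNz : W (- z) by rewrite -scaleN1r; exact: WZ.
    rewrite lerBrDl; have := sublinear_ge sq Wz (WZ t Wy).
    suff -> : q (t *: y) = t * q y by [].
    move: t0; rewrite le_eqVlt => /predU1P[<-|t0]; last exact: sublinearZ.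
    by rewrite scale0r mul0r (sublinear0 sq Wx).
  have S0 z : S z !=set0 by exists (q (z + 0 *: y) - 0 * q y); exists 0; rewrite /=.
  have qy_le z t : W z -> 0 <= t -> qy z <= q (z + t *: y) - t * q y.
    move=> Wz t0; apply: ge_inf; last by exists t.
    by exists (- q (- z)); exact: Slb.
  have qyq z : W z -> qy z <= q z.
    by move=> Wz; have := qy_le z 0 Wz (lexx 0); rewrite scale0r addr0 mul0r subr0.
  have sqy : sublinear qy.
    split=> [u v Wu Wv|a u a0 Wu].
      rewrite -lerBlDr; apply: lb_le_inf => // _ [t /= t0 <-].
      rewrite lerBlDr -lerBlDl; apply: lb_le_inf => // _ [s /= s0 <-].
      rewrite lerBlDl; apply: le_trans (qy_le _ (t + s) (WD Wu Wv) (addr_ge0 t0 s0)) _.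
      rewrite scalerDl addrACA; have := qD _ _ (WD Wu (WZ t Wy)) (WD Wv (WZ s Wy)); lra.
    rewrite -ler_pdivrMl//; apply: lb_le_inf => // _ [t /= t0 <-].
    rewrite ler_pdivrMl//; apply: le_trans (qy_le _ (a * t) (WZ a Wu) _) _.
      by rewrite mulr_ge0// ltW.
    by rewrite -scalerA -scalerDr mulrBr -mulrA lerD2r qZ//; apply: WD => //; exact: WZ.
  have okqy := extend qy sqy (fun z Wz => le_trans (qyq z Wz) (qP z Wz)).
  have := qmin (exist _ _ okqy).
  have -> : le (exist _ q okq) (exist _ _ okqy).
    apply/asboolP => z /=; case: ifPn => [/set_mem Wz|]; first exact: qyq.
    by move=> /negP nWz; rewrite q0// => Wz; apply: nWz; rewrite mem_set.
  move=> /(_ isT)/(congr1 sval)/= /(congr1 (fun f => f x)).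
  rewrite mem_set// => qyx; have := qy_le x 1 Wx ler01.
  by rewrite qyx scale1r mul1r lerBrDr.
have qN x : W x -> q (- x) = - q x.
  move=> Wx; have WNx : W (- x) by rewrite -scaleN1r; exact: WZ.
  by have := qadd x (- x) Wx WNx; rewrite subrr (sublinear0 sq Wx); lra.
exists q; split => // a x Wx.
have [a0|a0|->] := ltgtP a 0; last first.
- by rewrite scale0r mul0r (sublinear0 sq Wx).
- exact: sublinearZ.
- have := sublinearZ sq (_ : 0 < - a) Wx; rewrite oppr_gt0 => /(_ a0).
  by rewrite scaleNr qN ?mulNr; [move/oppr_inj|exact: WZ].
Qed.

End HahnBanach.

(** ** Averaging and the mean ergodic theorem *)

Lemma real_cauchy_limit (R : realType) (a : nat -> R) :
  (forall e, 0 < e -> exists N, forall n m, (N <= n)%N -> (N <= m)%N -> `|a n - a m| <= e) ->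
  exists l, forall e, 0 < e -> exists N, forall n, (N <= n)%N -> `|a n - l| <= e.
Proof.
move=> ca; have /cvg_ex[l al] : cvgn a.
  apply: cauchy_cvg; apply: cauchy_exP => e e0.
  have [N aN] := ca (e / 2) (divr_gt0 e0 (ltr0Sn R 1)).
  exists (a N); exists N => // n /= Nn.
  rewrite -ball_normE /=; apply: le_lt_trans (aN N n (leqnn _) Nn) _; lra.
exists l => e e0; have /cvgrPdist_le/(_ e e0)[N _ aN] := al.
by exists N => n /aN; rewrite distrC.
Qed.

Lemma eq_of_dist_le (R : realType) (a b : R) : (forall e, 0 < e -> `|a - b| <= e) -> a = b.
Proof.
move=> ab; apply/eqP; rewrite -subr_eq0 -normr_le0.
by apply/ler_addgt0Pr => e e0; rewrite add0r ab.
Qed.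

Section Averaging.
Variables (R : realType) (G : groupType) (X : ptopologicalType).
Variable alpha : continuous_action G X.

(** The convex hull of the translation operators. Generating it by binary combinations reduces each
    property of averages to one translate and one convexity step. *)
Inductive averaging : ((X -> R) -> X -> R) -> Prop :=
| averaging_act g : averaging (fun f x => f (alpha g x))
| averaging_mix t S T : 0 <= t <= 1 -> averaging S -> averaging T ->
    averaging (fun f x => t * S f x + (1 - t) * T f x).

Lemma averaging_continuous T f : averaging T -> continuous f -> continuous (T f).
Proof.
move=> aT cf; elim: aT => [g|t S S' _ _ cS _ cS']; first exact: continuous_act_comp.
by cts.
Qed.

Lemma averagingB T f g x : averaging T -> T (fun x => f x - g x) x = T f x - T g x.
Proof. by elim=> [//|t S S' _ _ -> _ ->]; ring. Qed.

Lemma averaging_le T B f : averaging T -> (forall x, `|f x| <= B) ->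
  forall x, `|T f x| <= B.
Proof.
move=> aT fB; elim: aT => [g x|t S S' t01 _ IH _ IH' x]; first exact: fB.
have -> : B = t * B + (1 - t) * B by ring.
case/andP: t01 => t0 t1; rewrite (le_trans (ler_normD _ _))// lerD// normrM.
  by rewrite ger0_norm// ler_wpM2l.
by rewrite ger0_norm ?subr_ge0// ler_wpM2l ?subr_ge0.
Qed.

Lemma averaging_comp S T : averaging S -> averaging T -> averaging (fun f => S (T f)).
Proof.
move=> aS aT; elim: aS => [g|t S1 S2 t01 _ IH1 _ IH2]; last exact: averaging_mix.
elim: aT => [h|t S1 S2 t01 _ IH1 _ IH2]; last exact: averaging_mix.
rewrite (_ : (fun f => _) = fun f x => f (alpha (h * g)%g x)); first exact: averaging_act.
by apply/funext => f; apply/funext => x; rewrite actM.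
Qed.

Variables (p : (X -> R) -> R) (ip : invariant_state alpha p).
Let sp : state p := ip.1.

Lemma averaging_state T f : averaging T -> continuous f -> p (T f) = p f.
Proof.
move=> aT cf; elim: aT => [g|t S S' _ aS IH aS' IH']; first exact: ip.2.
have cS := averaging_continuous aS cf; have cS' := averaging_continuous aS' cf.
rewrite (stateP sp)//; last by cts.
by rewrite (stateZ sp)// IH IH'; ring.
Qed.

(** Further averaging never spoils an approximation of a constant; this is what makes merging two
    averages possible in [uniform_average]. *)
Lemma averaging_dist_le T f c : averaging T -> continuous f ->
  p (fun x => `|T f x - c|) <= p (fun x => `|f x - c|).
Proof.
move=> aT cf; elim: aT => [g|t S S' /andP[t0 t1] aS IH aS' IH'].
  by rewrite (ip.2 g (fun x => `|f x - c|))//; cts.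
have cS := averaging_continuous aS cf; have cS' := averaging_continuous aS' cf.
apply: le_trans (_ : t * p (fun x => `|S f x - c|) + (1 - t) * p (fun x => `|S' f x - c|) <= _); last first.
  have -> : p (fun x => `|f x - c|) = t * p (fun x => `|f x - c|) + (1 - t) * p (fun x => `|f x - c|) by ring.
  by apply: lerD; apply: ler_wpM2l; rewrite ?subr_ge0.
rewrite -(stateZ sp (1 - t)) -?(stateP sp); [|cts..].
apply: (le_state sp); [cts|cts|move=> x].
have -> : t * S f x + (1 - t) * S' f x - c = t * (S f x - c) + (1 - t) * (S' f x - c) by ring.
have t1' : 0 <= 1 - t by rewrite subr_ge0.
by rewrite (le_trans (ler_normD _ _))// !normrM (ger0_norm t0) (ger0_norm t1').
Qed.

Hypothesis cX : compact [set: X].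
Hypothesis extp : forall p1 p2 t, invariant_state alpha p1 -> invariant_state alpha p2 ->
  0 < t < 1 -> (forall f, continuous f -> p f = t * p1 f + (1 - t) * p2 f) ->
  forall f, continuous f -> p1 f = p f.

(** The midpoint of two averages is an average, so its squared norm is at least [D]; the
    parallelogram identity then bounds the difference of two almost minimizing averages. *)
Lemma parallelogram S T f D a : averaging S -> averaging T -> continuous f ->
  (forall T, averaging T -> D <= p (fun x => T f x ^+ 2)) ->
  p (fun x => S f x ^+ 2) <= D + a -> p (fun x => T f x ^+ 2) <= D + a ->
  p (fun x => (S f x - T f x) ^+ 2) <= 4 * a.
Proof.
move=> aS aT cf Dle Sa Ta.
have h01 : 0 <= (2^-1 : R) <= 1 by apply/andP; split; lra.
have := Dle _ (averaging_mix h01 aS aT).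
have cS := averaging_continuous aS cf; have cT := averaging_continuous aT cf.
have -> : (fun x => (S f x - T f x) ^+ 2) = fun x => (2 * S f x ^+ 2 + 2 * T f x ^+ 2) -
  4 * (2^-1 * S f x + (1 - 2^-1) * T f x) ^+ 2 by apply/funext => x; field.
rewrite (stateB sp); [|cts..].
rewrite (stateD sp) ?(stateZ sp); [|cts..].
lra.
Qed.

(* The minimizing sequence [k n] of averages of [f] is Cauchy in L^2(p) and
   asymptotically invariant, so [psi |-> lim p (psi * k n)] defines, after an
   affine normalization, an invariant state dominated by a multiple of [p]; by
   extremality it is [p]. *)
Lemma mean_ergodic f e : continuous f -> 0 < e ->
  exists2 T, averaging T & p (fun x => `|T f x - p f|) <= e.
Proof.
move=> cf e0; have [M M0 fM] := continuous_compact_bounded cX cf.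
pose S := [set p (fun x => T f x ^+ 2) | T in averaging].
have S0 : S !=set0.
  by exists (p (fun x => f (alpha 1%g x) ^+ 2)); exists (fun f x => f (alpha 1%g x)) => //; exact: averaging_act.
have Slb : lbound S 0.
  move=> _ [T aT <-]; apply: (state_ge0 sp) => [|x]; last exact: sqr_ge0.
  by have := averaging_continuous aT cf; move=> ?; cts.
have Sinf : has_inf S by split => //; exists 0.
pose D := inf S.
have Dle T : averaging T -> D <= p (fun x => T f x ^+ 2).
  by move=> aT; apply: ge_inf; [exists 0|exists T].
have /choice[T TP] (n : nat) : exists T, averaging T /\
    p (fun x => T f x ^+ 2) <= D + n.+1%:R^-1.
  have n0 : 0 < (n.+1%:R^-1 : R) by rewrite invr_gt0.
  have [_ [T aT <-] lt] := inf_adherent n0 Sinf.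
  by exists T; split => //; exact: ltW.
pose k n := T n f.
have ck n : continuous (k n) by case: (TP n) => aT _; exact: averaging_continuous.
have kM n x : `|k n x| <= M by case: (TP n) => aT _; exact: averaging_le.
have pk n : p (k n) = p f by case: (TP n) => aT _; exact: averaging_state.
have small d : 0 < d -> exists N : nat, 4 * N.+1%:R^-1 <= d :> R.
  move=> d0; exists (Num.truncn (4 / d)).
  rewrite ler_pdivrMr// -ler_pdivrMl// mulrC; exact/ltW/truncnS_gt.
have kD N n : (N <= n)%N -> p (fun x => k n x ^+ 2) <= D + N.+1%:R^-1.
  move=> Nn; case: (TP n) => _ /le_trans; apply.
  by rewrite lerD2l lef_pV2 ?posrE// ler_nat.
have kk N n m : (N <= n)%N -> (N <= m)%N ->
    p (fun x => (k n x - k m x) ^+ 2) <= 4 * N.+1%:R^-1.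
  move=> Nn Nm; case: (TP n) (TP m) => aT _ [aT' _].
  by apply: (parallelogram aT aT' cf Dle); exact: kD.
(* A translate of an almost minimizing average is again one, whence asymptotic invariance. *)
have kg g n : p (fun x => (k n x - k n (alpha g x)) ^+ 2) <= 4 * n.+1%:R^-1.
  case: (TP n) => aT kn.
  have aT' := averaging_comp (averaging_act g) aT.
  apply: (parallelogram aT aT' cf Dle) => //.
  by rewrite (ip.2 g (fun x => k n x ^+ 2))//; cts.
have /choice[l lP] (psi : X -> R) : exists l, continuous psi -> forall e, 0 < e ->
    exists N, forall n, (N <= n)%N -> `|p (fun x => psi x * k n x) - l| <= e.
  have [cpsi|] := pselect (continuous psi); last by exists 0.
  have [B B0 psiB] := continuous_compact_bounded cX cpsi.
  have [|l lP] := @real_cauchy_limit R (fun n => p (fun x => psi x * k n x)); last by exists l.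
  move=> d d0; have dB : 0 < d / B by rewrite divr_gt0.
  have [N HN] := small ((d / B) ^+ 2) (exprn_gt0 2 dB).
  exists N => n m Nn Nm; rewrite -(stateB sp); [|by have cn := ck n; have cm := ck m; cts..].
  under eq_fun do rewrite -mulrBr.
  have -> : d = B * (d / B) by rewrite mulrC divfK// gt_eqF.
  apply: (state_mul_le sp cpsi) => //; [|exact: ltW|exact: le_trans (kk N n m Nn Nm) HN].
  by have cn := ck n; have cm := ck m; cts.
have lN (psi : X -> R) d : continuous psi -> 0 < d -> exists n, `|p (fun x => psi x * k n x) - l psi| <= d.
  by move=> cpsi d0; have [N HN] := lP psi cpsi d d0; exists N; exact: HN.
have l_lin a (psi phi : X -> R) : continuous psi -> continuous phi ->
    l (fun x => a * psi x + phi x) = a * l psi + l phi.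
  move=> cpsi cphi; apply: eq_of_dist_le => d d0.
  have a0 : 0 < `|a| + 1 by rewrite ltr_wpDl.
  have d3 : 0 < d / 3 by rewrite divr_gt0.
  have cap : continuous (fun x => a * psi x + phi x) by cts.
  have [N1 H1] := lP _ cpsi _ (divr_gt0 d3 a0); have [N2 H2] := lP _ cphi _ d3.
  have [N3 H3] := lP _ cap _ d3.
  pose n := maxn N1 (maxn N2 N3); have cn := ck n.
  have := H1 n (leq_maxl _ _); have := H2 n (leq_trans (leq_maxl _ _) (leq_maxr _ _)).
  have := H3 n (leq_trans (leq_maxr _ _) (leq_maxr _ _)).
  have -> : (fun x => (a * psi x + phi x) * k n x) = fun x => a * (psi x * k n x) + phi x * k n x.
    by apply/funext => x; ring.
  rewrite (stateP sp); [|cts..].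
  set P1 := p _; set P2 := p _ => h3 h2 h1.
  have h1' : `|a * (P1 - l psi)| <= d / 3.
    rewrite normrM; apply: le_trans (ler_wpM2l (normr_ge0 a) h1) _.
    rewrite mulrCA -{2}[d / 3]mulr1 ler_wpM2l ?(ltW d3)//.
    by rewrite ler_pdivrMr// mul1r lerDl.
  move: h1' h2 h3; rewrite !ler_norml mulrBr; lra.
have l_le (psi : X -> R) B : continuous psi -> (forall n, p (fun x => psi x * k n x) <= B) -> l psi <= B.
  move=> cpsi H; apply/ler_addgt0Pr => d d0; have [n] := lN psi d cpsi d0.
  by have := H n; rewrite ler_norml; lra.
have l_ge (psi : X -> R) B : continuous psi -> (forall n, B <= p (fun x => psi x * k n x)) -> B <= l psi.
  move=> cpsi H; apply/ler_addgt0Pr => d d0; have [n] := lN psi d cpsi d0.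
  by have := H n; rewrite ler_norml; lra.
have l1 : l (fun=> 1) = p f.
  have k1 n : p (fun x => 1 * k n x) = p f.
    by rewrite -(pk n); congr p; apply/funext => x; rewrite mul1r.
  apply/eqP; rewrite eq_le; apply/andP; split.
    by apply: l_le => [|n]; [exact: cts_cst|rewrite k1].
  by apply: l_ge => [|n]; [exact: cts_cst|rewrite k1].
have l_act g (psi : X -> R) : continuous psi -> l (fun x => psi (alpha g x)) = l psi.
  move=> cpsi; apply: eq_of_dist_le => d d0.
  have [B B0 psiB] := continuous_compact_bounded cX cpsi.
  have cg := @continuous_act_comp _ _ _ alpha g _ cpsi.
  have d3 : 0 < d / 3 by rewrite divr_gt0.
  have [N1 H1] := lP _ cpsi _ d3; have [N2 H2] := lP _ cg _ d3.
  have dB : 0 < d / 3 / B by rewrite divr_gt0.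
  have [N3 H3] := small ((d / 3 / B) ^+ 2) (exprn_gt0 2 dB).
  pose n := maxn N1 (maxn N2 N3); have cn := ck n.
  have cng := @continuous_act_comp _ _ _ alpha g _ cn.
  have := H1 n (leq_maxl _ _); have := H2 n (leq_trans (leq_maxl _ _) (leq_maxr _ _)).
  rewrite -(ip.2 g (fun x => psi x * k n x)); last by cts.
  have : `|p (fun x => psi (alpha g x) * (k n x - k n (alpha g x)))| <= B * (d / 3 / B).
    apply: (state_mul_le sp cg) => //; [by cts|exact: ltW|].
    apply: le_trans (kg g n) _; apply: le_trans _ H3.
    rewrite ler_wpM2l// lef_pV2 ?posrE// ler_nat ltnS.
    exact: leq_trans (leq_maxr _ _) (leq_maxr _ _).
  under eq_fun do rewrite mulrBr.
  rewrite (stateB sp); [|cts..].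
  rewrite mulrC divfK ?gt_eqF// !ler_norml; lra.
pose c := p f; have cM : `|c| <= M by exact: (state_bounded sp cf).
(* As [|k n| <= M], the functional [l] lies between [- M * p] and [M * p] on nonnegative functions.
   Adding [M' * p] makes it positive, with total mass [c + M']. The factor [4 * M'] keeps [t * p1]
   below [p], so that the remainder [p2] is positive too. *)
pose M' := M + 1; pose t := (c + M') / (4 * M').
have M'0 : 0 < M' by rewrite /M'; lra.
have cM'0 : 0 < c + M' by move: cM; rewrite ler_norml /M'; lra.
have t0 : 0 < t by rewrite /t divr_gt0// mulr_gt0.
have t1 : t < 1.
  by rewrite /t ltr_pdivrMr ?mulr_gt0// mul1r; move: cM; rewrite ler_norml /M'; lra.
pose p1 (psi : X -> R) := (l psi + M' * p psi) / (c + M').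
pose p2 (psi : X -> R) := (p psi - t * p1 psi) / (1 - t).
have tp1 (psi : X -> R) : t * p1 psi = (l psi + M' * p psi) / (4 * M').
  by rewrite /t /p1; field; rewrite !gt_eqF.
have l_bounds (psi : X -> R) : continuous psi -> (forall x, 0 <= psi x) ->
    - M * p psi <= l psi <= M * p psi.
  move=> cpsi psi0; rewrite -!(stateZ sp)//; apply/andP; split.
    apply: l_ge => // n; have := ck n => cn; apply: (le_state sp); [cts|cts|move=> x].
    by rewrite mulrC ler_wpM2l//; have := kM n x; rewrite ler_norml => /andP[].
  apply: l_le => // n; have := ck n => cn; apply: (le_state sp); [cts|cts|move=> x].
  by rewrite mulrC ler_wpM2r//; have := kM n x; rewrite ler_norml => /andP[].
have i1 : invariant_state alpha p1.
  split; first split.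
  - move=> a psi phi cpsi cphi; rewrite /p1 l_lin// (stateP sp)//.
    by field; rewrite gt_eqF.
  - move=> psi cpsi psi0; have := l_bounds psi cpsi psi0.
    have := state_ge0 sp cpsi psi0 => pp /andP[lb _].
    by rewrite /p1 divr_ge0 ?(ltW cM'0)// /M' mulrDl mul1r; lra.
  - by rewrite /p1 l1 (state1 sp) mulr1 divff// gt_eqF.
  - by move=> g psi cpsi; rewrite /p1 l_act// ip.2.
have i2 : invariant_state alpha p2.
  split; first split.
  - move=> a psi phi cpsi cphi; rewrite /p2 !tp1 l_lin// (stateP sp)//.
    by field; rewrite ?gt_eqF// subr_gt0.
  - move=> psi cpsi psi0; have := l_bounds psi cpsi psi0.
    have := state_ge0 sp cpsi psi0 => pp /andP[_ ub].
    rewrite /p2 divr_ge0 ?subr_ge0 ?(ltW t1)// tp1 ler_pdivrMr ?mulr_gt0//.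
    have : 0 <= M * p psi by rewrite mulr_ge0// ltW.
    by move: ub; rewrite /M'; lra.
  - by rewrite /p2 tp1 l1 (state1 sp) /t mulr1 divff// gt_eqF// subr_gt0.
  - by move=> g psi cpsi; rewrite /p2 /p1 l_act// ip.2.
have lE (psi : X -> R) : continuous psi -> l psi = c * p psi.
  move=> cpsi; have t01 : 0 < t < 1 by rewrite t0 t1.
  have := extp i1 i2 t01 _ cpsi; rewrite /p1 => E.
  have : (l psi + M' * p psi) / (c + M') = p psi.
    apply: E => phi cphi; rewrite -/(p1 phi) /p2 [(1 - t) * _]mulrC divfK ?subrKC//.
    by rewrite gt_eqF// subr_gt0.
  by move/(congr1 (fun z => z * (c + M'))); rewrite divfK ?gt_eqF//; lra.
(* The variance of [k m] is p(k_m^2) - c^2. Here p(k_m^2) is close to p(k_m k_n) for large n, and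
   this to l(k_m) = c p(k_m) = c^2; each of the two errors is at most [e ^+ 2 / 2]. *)
have e2 : 0 < e ^+ 2 / 2 by rewrite divr_gt0// exprn_gt0.
have e2M : 0 < e ^+ 2 / 2 / M by rewrite divr_gt0.
have [m Hm] := small ((e ^+ 2 / 2 / M) ^+ 2) (exprn_gt0 2 e2M).
exists (T m); first by case: (TP m).
apply: (state_norm_le sp) => //; first by have := ck m => cm; cts.
have cm := ck m; have [N HN] := lP _ cm _ e2.
pose n := maxn N m; have cn := ck n.
have := HN n (leq_maxl _ _); rewrite (lE _ cm) pk -/c.
have : `|p (fun x => k m x * (k m x - k n x))| <= M * (e ^+ 2 / 2 / M).
  apply: (state_mul_le sp cm) => //; [by cts|exact: ltW|].
  exact: le_trans (kk m m n (leqnn _) (leq_maxr _ _)) Hm.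
rewrite [M * _]mulrC divfK ?gt_eqF//.
have -> : (fun x => k m x * (k m x - k n x)) = fun x => k m x ^+ 2 - k m x * k n x.
  by apply/funext => x; ring.
have -> : (fun x => (T m f x - p f) ^+ 2) = fun x => (k m x ^+ 2 - 2 * c * k m x) + c ^+ 2.
  by apply/funext => x; rewrite /k /c; ring.
rewrite (stateB sp); [|cts..].
rewrite (stateD sp); [|cts..].
rewrite (stateB sp); [|cts..].
rewrite (stateZ sp)// (state_cst sp) pk -/c !ler_norml; lra.
Qed.

End Averaging.

(** * Amenability brings averages of one function uniformly close *)

Section AmenableAveraging.
Variables (R : realType) (G : groupType) (X : ptopologicalType).
Variable alpha : continuous_action G X.
Hypothesis aG : amenable R G.

Lemma bounded_fun_le (T : Type) (u : T -> R) B : (forall x, `|u x| <= B) -> bounded_fun u.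
Proof.
move=> uB; exists B; split; first exact: num_real.
by move=> M BM x _ /=; rewrite (le_trans (uB x))// ltW.
Qed.

(* If averages of [T f - T' f] stay at distance [d] from 0, Hahn-Banach gives
   a bounded functional which is at least [d] on all of them; integrating it
   along the orbit with the invariant mean gives 0. *)
Lemma amenable_averaging T T' (f : X -> R) B d :
  averaging alpha T -> averaging alpha T' -> (forall x, `|f x| <= B) -> 0 < d ->
  exists2 S, averaging alpha S & forall x, `|S (T f) x - S (T' f) x| <= d.
Proof.
move=> aT aT' fB d0; apply: contrapT => nS.
pose z : X -> R^o := fun x => T f x - T' f x.
have big S : averaging alpha S -> exists x, d < `|S z x|.
  move=> aS; apply: contrapT => nx; apply: nS; exists S => // x.
  rewrite -(averagingB _ _ _ aS) leNgt; apply/negP => dx; apply: nx; exists x.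
  by [].
pose W : set (X -> R^o) := [set v | exists B, forall x, `|v x| <= B].
have WD u v : W u -> W v -> W (u + v).
  move=> [C uC] [D vD]; exists (C + D) => x.
  by rewrite (le_trans (ler_normD _ _))// lerD.
have WZ a v : W v -> W (a *: v).
  by move=> [C vC]; exists (`|a| * C) => x; rewrite normrM ler_wpM2l.
(* [P v] is the infimum of ||v + t S z|| - t d over averages [S] and t >= 0, finite because ||S z||
   > d by [big]. A linear [L] below [P] satisfies |L v| <= ||v|| (t = 0) and L(S z) >= d (v = - S z,
   t = 1). *)
pose E (v : X -> R^o) := [set r : R | exists S t, [/\ averaging alpha S, 0 <= t &
  forall x, `|v x + t * S z x| <= r + t * d]].
have E_bound v C : (forall x, `|v x| <= C) -> E v C.
  move=> vC; exists (fun f x => f (alpha 1%g x)), 0; split => //; first exact: averaging_act.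
  by move=> x; rewrite !mul0r !addr0.
have E_lb v C : (forall x, `|v x| <= C) -> lbound (E v) (- C).
  move=> vC r [S [t [aS t0 H]]]; have [x dx] := big S aS.
  have := H x; have := vC x; have := lerB_normD (t * S z x) (v x).
  rewrite [t * _ + _]addrC normrM (ger0_norm t0).
  by have := ler_wpM2l t0 (ltW dx); lra.
pose P v := inf (E v).
have P_le v r : W v -> E v r -> P v <= r.
  by move=> [C vC] Er; apply: ge_inf => //; exists (- C); exact: E_lb.
have P_ge v c : W v -> lbound (E v) c -> c <= P v.
  by move=> [C vC] lb; apply: lb_le_inf => //; exists C; exact: E_bound.
have sP : sublinear W P.
  split=> [u v Wu Wv|a v a0 Wv].
    rewrite -lerBlDr; apply: (P_ge) => // r [S1 [t1 [aS1 t10 H1]]].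
    rewrite lerBlDr -lerBlDl; apply: (P_ge) => // s [S2 [t2 [aS2 t20 H2]]].
    rewrite lerBlDl; apply: (P_le); first exact: WD.
    have [t0|t0] := eqVneq (t1 + t2) 0.
      have [t10' t20'] : t1 = 0 /\ t2 = 0 by split; lra.
      exists S1, 0; split => // x; rewrite !mul0r !addr0.
      apply: le_trans (ler_normD _ _) _.
      by have := H1 x; have := H2 x; rewrite t10' t20' !mul0r !addr0; lra.
    have tp : 0 < t1 + t2 by rewrite lt_neqAle eq_sym t0 addr_ge0.
    have l01 : 0 <= t1 / (t1 + t2) <= 1.
      by rewrite divr_ge0 ?addr_ge0//= ler_pdivrMr// mul1r lerDl.
    exists (fun f x => t1 / (t1 + t2) * S1 f x + (1 - t1 / (t1 + t2)) * S2 f x), (t1 + t2).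
    split; [exact: (averaging_mix l01 aS1 aS2)|exact: addr_ge0|move=> x].
    have eqt (r1 r2 : R) : (t1 + t2) * (t1 / (t1 + t2) * r1 + (1 - t1 / (t1 + t2)) * r2) =
        t1 * r1 + t2 * r2 by field.
    rewrite eqt -[(u + v) x]/(u x + v x) addrACA.
    apply: le_trans (ler_normD _ _) _; have := H1 x; have := H2 x; lra.
  rewrite -ler_pdivrMl//; apply: (P_ge) => // r [S [t [aS t0 H]]].
  rewrite ler_pdivrMl//; apply: (P_le); first exact: WZ.
  exists S, (a * t); split => //; first by rewrite mulr_ge0// ltW.
  move=> x; have -> : (a *: v) x + a * t * S z x = a * (v x + t * S z x).
    by rewrite mulrDr mulrA.
  by rewrite normrM gtr0_norm// -mulrA -mulrDr ler_pM2l.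
have [L [LD LZ LP]] := hahn_banach WD WZ sP.
have LB v C : (forall x, `|v x| <= C) -> `|L v| <= C.
  move=> vC; have Wv : W v by exists C.
  have WNv : W (-1 *: v) by exact: WZ.
  rewrite ler_norml lerNl -mulN1r -LZ//; apply/andP; split.
    apply: le_trans (LP _ WNv) _; apply: (P_le) => //; apply: E_bound => x.
    by rewrite -[(_ *: _) x]/(-1 * v x) mulN1r normrN.
  by apply: le_trans (LP _ Wv) _; apply: (P_le) => //; exact: E_bound.
have Wavg S u C : averaging alpha S -> (forall x, `|u x| <= C) -> W (S u).
  by move=> aS uC; exists C => x; exact: averaging_le aS uC x.
have zB : forall x, `|z x| <= B + B.
  move=> x; rewrite (le_trans (ler_normB _ _))// lerD//.
    exact: (averaging_le aT fB).
  exact: (averaging_le aT' fB).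
have Ld S : averaging alpha S -> d <= L (S z).
  move=> aS; have WS : W (S z) by exact: Wavg zB.
  have WNS : W (-1 *: S z) by exact: WZ.
  rewrite -lerN2 -mulN1r -LZ//; apply: le_trans (LP _ WNS) _; apply: (P_le) => //.
  exists S, 1; split => // x.
  by rewrite !mul1r addNr -[(_ *: _) x]/(-1 * S z x) mulN1r addNr normr0.
have [m [mD m0 m1 mG]] := aG.
pose u T g := L (fun x => T f (alpha g x)).
have cB T0 g : averaging alpha T0 -> forall x, `|T0 f (alpha g x)| <= B.
  by move=> aT0 x; exact: (averaging_le aT0 fB).
have uB T0 g : averaging alpha T0 -> `|u T0 g| <= B.
  by move=> aT0; apply: LB; exact: cB.
have bu T0 : averaging alpha T0 -> bounded_fun (u T0).
  by move=> aT0; apply: (@bounded_fun_le _ _ B) => g; exact: uB.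
have bZ a T0 : averaging alpha T0 -> bounded_fun (fun g => a * u T0 g).
  move=> aT0; apply: (@bounded_fun_le _ _ (`|a| * B)) => g.
  by rewrite normrM ler_wpM2l// uB.
have bc c : bounded_fun (fun _ : G => c : R) by exact: (@bounded_fun_le _ _ `|c|).
have mc c : m (fun=> c) = c.
  have m00 : m (fun=> 0) = 0.
    have := mD 1 _ _ (bc 0) (bc 0).
    rewrite (_ : (fun h : G => 1 * 0 + 0) = fun=> 0); first by lra.
    by apply/funext => h; rewrite mulr0 addr0.
  have := mD c _ _ (bc 1) (bc 0).
  by rewrite m1 m00 mulr1 !addr0.
have mZ a T0 : averaging alpha T0 -> m (fun g => a * u T0 g) = a * m (u T0).
  move=> aT0; have := mD a _ _ (bu _ aT0) (bc 0); rewrite mc addr0 => <-.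
  by congr m; apply/funext => g; rewrite addr0.
(* For the translate by [s], [u] is the orbit function of [f] shifted on the left by [s]. So left
   invariance gives all averages the same mean, whereas [ud] below keeps the means of [T] and [T']
   at least [d] apart. *)
have mu T0 : averaging alpha T0 -> m (u T0) = m (u (fun f x => f (alpha 1%g x))).
  have a1 : averaging alpha _ := @averaging_act R _ _ alpha 1%g.
  elim=> [s|t S S' t01 aS IH aS' IH'].
    rewrite -(mG s^-1%g _ (bu _ a1)); congr m; apply/funext => h.
    by rewrite /u invgK; congr L; apply/funext => x; rewrite actM act1.
  have -> : u (fun f x => t * S f x + (1 - t) * S' f x) =
      fun h => t * u S h + (1 - t) * u S' h.
    apply/funext => h; rewrite /u.
    have WS : W (fun x => S f (alpha h x)) by exists B; exact: cB.
    have WS' : W (fun x => S' f (alpha h x)) by exists B; exact: cB.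
    by rewrite -!LZ// -LD//; exact: WZ.
  by rewrite mD ?mZ ?IH ?IH'//; [ring|exact: bu|exact: bZ].
have ud g : 0 <= -1 * u T' g + (1 * u T g + - d).
  have aA : averaging alpha _ := @averaging_act R _ _ alpha g.
  have := Ld _ aA.
  have WT : W (fun x => T f (alpha g x)) by exists B; exact: cB.
  have WT' : W (fun x => T' f (alpha g x)) by exists B; exact: cB.
  rewrite (_ : (fun x => _) = (fun x => T f (alpha g x)) + -1 *: (fun x => T' f (alpha g x))).
    by rewrite LD ?LZ//; [rewrite /u; lra|exact: WZ].
  apply/funext => x.
  by rewrite -[RHS]/(T f (alpha g x) + -1 * T' f (alpha g x)) mulN1r.
have bd : bounded_fun (fun g => 1 * u T g + - d).
  apply: (@bounded_fun_le _ _ (B + d)) => g.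
  by rewrite mul1r (le_trans (ler_normB _ _))// lerD ?uB// gtr0_norm.
have := m0 _ _ ud; rewrite mD//; last by exact: bu.
rewrite mD//; last by exact: bu.
rewrite mc (mu _ aT) (mu _ aT') => H.
suff : 0 <= - d by lra.
apply: le_trans (H _) _; last by lra.
apply: (@bounded_fun_le _ _ (B + (B + d))) => g.
rewrite (le_trans (ler_normD _ _))// lerD//.
  by rewrite normrM normrN1 mul1r uB.
by rewrite mul1r (le_trans (ler_normB _ _))// lerD ?uB// gtr0_norm.
Qed.

End AmenableAveraging.

(** ** Uniform approximation on the ergodic boundary *)

Section UniformAverages.
Variables (R : realType) (G : groupType) (X : ptopologicalType).
Variable alpha : continuous_action G X.
Hypotheses (aG : amenable R G) (cX : compact [set: X]) (perf : perfect_space R X).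
Hypothesis cE : compact (E_G R alpha).
Let E := E_G R alpha.

Lemma state_dist_triangle (p : (X -> R) -> R) (u v w : X -> R) : state p ->
  continuous u -> continuous v -> continuous w ->
  p (fun x => `|u x - w x|) <= p (fun x => `|u x - v x|) + p (fun x => `|v x - w x|).
Proof.
move=> sp cu cv cw; rewrite -(stateD sp); [|cts..].
by apply: (le_state sp); [cts|cts|move=> x; exact: ler_distD].
Qed.

Lemma E_G_state q : E q -> state (ev q).
Proof. by move=> Eq; case: (E_G_invariant_state cX perf Eq). Qed.

Lemma mean_ergodic_E_G q (f : X -> R) e : E q -> continuous f -> 0 < e ->
  exists2 T, averaging alpha T & ev q (fun x => `|T f x - ev q f|) <= e.
Proof.
move=> Eq cf e0.
apply: (mean_ergodic (E_G_invariant_state cX perf Eq) cX _ cf e0).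
by move=> p1 p2 t i1 i2 t01; exact: (E_G_extreme cX perf Eq i1 i2 t01).
Qed.

(** Near each q an average is provided by [mean_ergodic]. If [T1] is good on [Y] and [T2] on [Z], an
    [S] with [S (T1 f)] and [S (T2 f)] uniformly close makes [S] after [T1] good on both. Each
    merger costs a little, hence the slack [e' < e] in the glued property. *)
Lemma uniform_average (f : X -> R) e : continuous f -> 0 < e ->
  exists2 T, averaging alpha T &
    forall q, E q -> ev q (fun x => `|T f x - ev q f|) <= e.
Proof.
move=> cf e0; have [B B0 fB] := continuous_compact_bounded cX cf.
pose I (Z : set (functionals R X)) := exists2 e', e' < e &
  exists2 T, averaging alpha T &
    forall q, E q -> Z q -> ev q (fun x => `|T f x - ev q f|) <= e'.
suff [e' e'e [T aT H]] : I E.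
  by exists T => // q Eq; apply: le_trans (H q Eq Eq) _; exact: ltW.
apply: (compact_ideal cE).
- by exists 0 => //; exists (fun f x => f (alpha 1%g x)); [exact: averaging_act|].
- move=> Y Z [e1 e1e [T1 aT1 H1]] [e2 e2e [T2 aT2 H2]].
  pose d := (e - Num.max e1 e2) / 2.
  have m1 : e1 <= Num.max e1 e2 by rewrite le_max lexx.
  have m2 : e2 <= Num.max e1 e2 by rewrite le_max lexx orbT.
  have me : Num.max e1 e2 < e by rewrite gt_max e1e e2e.
  have d0 : 0 < d by rewrite divr_gt0// subr_gt0.
  have [S aS HS] := amenable_averaging aG aT1 aT2 fB d0.
  exists (Num.max e1 e2 + d); first by rewrite /d; lra.
  exists (fun f => S (T1 f)); first exact: averaging_comp.
  move=> q Eq; have iq := E_G_invariant_state cX perf Eq; have sq := E_G_state Eq.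
  have cT1 := averaging_continuous aT1 cf; have cT2 := averaging_continuous aT2 cf.
  have cS1 := averaging_continuous aS cT1; have cS2 := averaging_continuous aS cT2.
  case=> [Yq|Zq].
    apply: le_trans (averaging_dist_le iq (ev q f) aS cT1) _.
    by apply: le_trans (H1 q Eq Yq) _; lra.
  apply: le_trans (state_dist_triangle sq cS1 cS2 (cts_cst (ev q f))) _.
  rewrite addrC lerD//.
    apply: le_trans (averaging_dist_le iq (ev q f) aS cT2) _.
    exact: le_trans (H2 q Eq Zq) _.
  by rewrite -[leRHS](state_cst sq); apply: (le_state sq) => //; cts.
- move=> Y Z YZ [e' e'e [T aT H]]; exists e' => //; exists T => // q Eq Yq.
  by apply: H => //; exact: YZ.
- move=> q Eq; have e4 : 0 < e / 4 by rewrite divr_gt0.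
  have [T aT Tq] := mean_ergodic_E_G Eq cf e4.
  have cT := averaging_continuous aT cf.
  have cd : continuous (fun x => `|T f x - ev q f|) by cts.
  have c1 := ev_continuous cd; have c2 := ev_continuous cf.
  exists ([set r | ev r (fun x => `|T f x - ev q f|) < e / 2] `&`
          [set r | `|ev r f - ev q f| < e / 4]).
    apply: open_nbhs_nbhs; split; last by split => /=; rewrite ?subrr ?normr0//; lra.
    apply: openI; first exact: open_lt_continuous.
    by apply: open_lt_continuous; cts.
  exists (e / 2 + e / 4); first by lra.
  exists T => // r Er [/= h1 h2]; have sr := E_G_state Er.
  apply: le_trans (state_dist_triangle sr cT (cts_cst (ev q f)) (cts_cst (ev r f))) _.
  by rewrite (state_cst sr) lerD ?(ltW h1)// distrC ltW.
Qed.

Definition approximable (c : functionals R X -> R) : Prop :=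
  forall e, 0 < e -> exists2 k : X -> R, continuous k &
    forall q, E q -> ev q (fun x => `|k x - c q|) <= e.

Lemma approximable_ev (f : X -> R) : continuous f -> approximable (fun q => ev q f).
Proof.
move=> cf e e0; have [T aT H] := uniform_average cf e0.
by exists (T f) => //; exact: (averaging_continuous aT cf).
Qed.

Lemma approximable_cst (a : R) : approximable (fun=> a).
Proof.
move=> e e0; exists (fun=> a) => [|q Eq]; first exact: cts_cst.
by rewrite subrr normr0 (state_cst (E_G_state Eq)) ltW.
Qed.

Lemma approximable_affine (a b : R) c : approximable c -> approximable (fun q => a * c q + b).
Proof.
move=> Ac e e0; have a0 : 0 < `|a| + 1 by rewrite ltr_wpDl.
have [k ck H] := Ac _ (divr_gt0 e0 a0).
exists (fun x => a * k x + b) => [|q Eq]; first by cts.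
have sq := E_G_state Eq.
have -> : (fun x => `|a * k x + b - (a * c q + b)|) = fun x => `|a| * `|k x - c q|.
  by apply/funext => x; rewrite -normrM; congr `|_|; ring.
rewrite (stateZ sq); last by cts.
apply: le_trans (ler_wpM2l (normr_ge0 a) (H q Eq)) _.
rewrite mulrCA -[leRHS]mulr1 ler_wpM2l ?(ltW e0)//.
by rewrite ler_pdivrMr// mul1r lerDl.
Qed.

Lemma approximable_lattice (m : R -> R -> R) c1 c2 :
  (forall k1 k2 : X -> R, continuous k1 -> continuous k2 -> continuous (fun x => m (k1 x) (k2 x))) ->
  (forall s t s' t', `|m s t - m s' t'| <= `|s - s'| + `|t - t'|) ->
  approximable c1 -> approximable c2 -> approximable (fun q => m (c1 q) (c2 q)).
Proof.
move=> cm lm A1 A2 e e0; have e2 : 0 < e / 2 by rewrite divr_gt0.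
have [k1 ck1 H1] := A1 _ e2; have [k2 ck2 H2] := A2 _ e2.
have ck := cm _ _ ck1 ck2.
exists (fun x => m (k1 x) (k2 x)) => // q Eq; have sq := E_G_state Eq.
apply: le_trans (_ : ev q (fun x => `|k1 x - c1 q| + `|k2 x - c2 q|) <= _).
  apply: (le_state sq) => [|| x]; [|by cts|exact: lm].
  apply: (@cts_norm _ _ (fun x => m (k1 x) (k2 x) - m (c1 q) (c2 q))).
  apply: (@cts_add _ _ (fun x => m (k1 x) (k2 x)) (fun=> - m (c1 q) (c2 q))) => //.
  exact: cts_cst.
rewrite (stateD sq); [|cts..].
by have := H1 q Eq; have := H2 q Eq; lra.
Qed.

Lemma approximable_max c1 c2 : approximable c1 -> approximable c2 ->
  approximable (fun q => Num.max (c1 q) (c2 q)).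
Proof.
apply: approximable_lattice => [k1 k2 h1 h2|s t s' t']; first exact: cts_max.
rewrite ler_norml !maxEle; have := ler_norm (s - s'); have := ler_norm (t - t').
have := ler_norm (s' - s); have := ler_norm (t' - t).
rewrite (distrC s') (distrC t').
by case: (leP s t) => h1; case: (leP s' t') => h2 *; apply/andP; split; lra.
Qed.

Lemma approximable_min c1 c2 : approximable c1 -> approximable c2 ->
  approximable (fun q => Num.min (c1 q) (c2 q)).
Proof.
apply: approximable_lattice => [k1 k2 h1 h2|s t s' t']; first exact: cts_min.
rewrite ler_norml !minEle; have := ler_norm (s - s'); have := ler_norm (t - t').
have := ler_norm (s' - s); have := ler_norm (t' - t).
rewrite (distrC s') (distrC t').
by case: (leP s t) => h1; case: (leP s' t') => h2 *; apply/andP; split; lra.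
Qed.

(* Kakutani-Stone: the continuous approximable functions form a lattice
   interpolating any values at two points of [E]. *)
Lemma approximable_locally_constant (c : functionals R X -> R) :
  (forall q, E q -> exists2 U, nbhs q U & forall r, E r -> U r -> c r = c q) ->
  approximable c.
Proof.
move=> cloc.
pose A (a : functionals R X -> R) := continuous a /\ approximable a.
have Acst a : A (fun=> a) by split; [exact: cts_cst|exact: approximable_cst].
have Amax a b : A a -> A b -> A (fun q => Num.max (a q) (b q)).
  by move=> [ca Aa] [cb Ab]; split; [exact: cts_max|exact: approximable_max].
have Amin a b : A a -> A b -> A (fun q => Num.min (a q) (b q)).
  by move=> [ca Aa] [cb Ab]; split; [exact: cts_min|exact: approximable_min].
have interp p q : exists a, [/\ A a, a p = c p & a q = c q].
  have [<-|pq] := pselect (p = q); first by exists (fun=> c p).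
  have [k pqk] : exists k, p k <> q k.
    by apply: contrapT => /forallNP npq; apply: pq; apply/funext => k; apply: contrapT => /npq.
  have ck : continuous (k : X -> R) by exact: cts_fun.
  have d0 : ev q k - ev p k != 0.
    by rewrite subr_eq0 !evE; apply/eqP => h; apply: pqk.
  pose s := (c q - c p) / (ev q k - ev p k).
  exists (fun r => s * ev r k + (c p - s * ev p k)); split.
  - split; last exact: approximable_affine (approximable_ev ck).
    by have cev := ev_continuous ck; cts.
  - by ring.
  - by rewrite /s; field.
(* Minima give the upper bound on all of [E] with the lower bound kept at [p]; afterwards, in
   [approx], maxima of such functions give the lower bound everywhere. *)
have upper p e : E p -> 0 < e -> exists a, [/\ A a, c p - e < a p &
    forall q, E q -> a q < c q + e].
  move=> Ep e0; pose I (Z : set (functionals R X)) := exists a, [/\ A a, c p - e < a p &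
    forall q, E q -> Z q -> a q < c q + e].
  suff [a [Aa ap aE]] : I E by exists a; split => // q Eq; exact: aE.
  apply: (compact_ideal cE).
  - by exists (fun=> c p); split => //; lra.
  - move=> Y Z [a [Aa ap aY]] [b [Ab bp bZ]].
    exists (fun q => Num.min (a q) (b q)); split; [exact: Amin|by rewrite lt_min ap bp|].
    by move=> q Eq [/(aY q Eq)|/(bZ q Eq)] h; rewrite gt_min h ?orbT.
  - by move=> Y Z YZ [a [Aa ap aZ]]; exists a; split => // q Eq /YZ; exact: aZ.
  - move=> q Eq; have [a [Aa ap aq]] := interp p q.
    have [U Uq cU] := cloc q Eq.
    exists (U `&` [set r | a r < c q + e]).
      apply: filterI => //; apply: open_nbhs_nbhs; split; last by rewrite /= aq; lra.
      by apply: open_lt_continuous; case: Aa.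
    exists a; split => // [|r Er [Ur /= ar]]; first by rewrite ap; lra.
    by rewrite (cU r).
have approx e : 0 < e -> exists2 a, A a & forall q, E q -> c q - e < a q < c q + e.
  move=> e0; have [[p Ep]|E0] := pselect (E !=set0); last first.
    by exists (fun=> 0) => // q Eq; case: E0; exists q.
  pose I (Z : set (functionals R X)) := exists a, [/\ A a,
    forall q, E q -> a q < c q + e & forall q, E q -> Z q -> c q - e < a q].
  suff [a [Aa aE1 aE2]] : I E by exists a => // q Eq; rewrite aE1 ?aE2.
  apply: (compact_ideal cE).
  - by have [a [Aa _ aE]] := upper p e Ep e0; exists a; split.
  - move=> Y Z [a [Aa aE aY]] [b [Ab bE bZ]].
    exists (fun q => Num.max (a q) (b q)); split; first exact: Amax.
      by move=> q Eq; rewrite gt_max aE ?bE.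
    by move=> q Eq [/(aY q Eq)|/(bZ q Eq)] h; rewrite lt_max h ?orbT.
  - by move=> Y Z YZ [a [Aa aE aZ]]; exists a; split => // q Eq /YZ; exact: aZ.
  - move=> q Eq; have [a [Aa aq aE]] := upper q e Eq e0.
    have [U Uq cU] := cloc q Eq.
    exists (U `&` [set r | c q - e < a r]).
      apply: filterI => //; apply: open_nbhs_nbhs; split => //.
      by apply: open_gt_continuous; case: Aa.
    by exists a; split => // r Er [Ur /= ar]; rewrite (cU r).
move=> e e0; have e2 : 0 < e / 2 by rewrite divr_gt0.
have [a [_ Aa] ac] := approx _ e2; have [k ck kH] := Aa _ e2.
exists k => // q Eq; have sq := E_G_state Eq.
apply: le_trans (state_dist_triangle sq ck (cts_cst (a q)) (cts_cst (c q))) _.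
have : `|a q - c q| <= e / 2.
  by rewrite ler_norml; have /andP[h1 h2] := ac q Eq; apply/andP; split; lra.
by rewrite (state_cst sq); have := kH q Eq; lra.
Qed.

End UniformAverages.

(** ** Perturbation of zero sets *)

Section Bump.
Variable R : realType.
Implicit Types eta t s : R.

(** A trapezoid: 1 for |t| <= eta, 0 for |t| >= 2 eta, with Lipschitz constant 1/eta. *)
Definition bump eta t : R := Num.max 0 (Num.min 1 (2 - `|t| / eta)).

Lemma bump_ge0 eta t : 0 <= bump eta t.
Proof. by rewrite le_max lexx. Qed.

Lemma bump_le1 eta t : bump eta t <= 1.
Proof. by rewrite ge_max ler01 ge_min lexx. Qed.

Lemma bump_eq1 eta t : 0 < eta -> `|t| <= eta -> bump eta t = 1.
Proof.
move=> eta0 teta; have : `|t| / eta <= 1 by rewrite ler_pdivrMr// mul1r.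
by rewrite /bump => h; rewrite (min_idPl _) ?(max_idPr _)//; lra.
Qed.

Lemma bump_eq0 eta t : 0 < eta -> 2 * eta <= `|t| -> bump eta t = 0.
Proof.
move=> eta0 teta; have h : 2 <= `|t| / eta by rewrite ler_pdivlMr.
by rewrite /bump (max_idPl _)// ge_min; apply/orP; right; lra.
Qed.

Lemma bump_lipschitz eta t s : 0 < eta -> bump eta t <= bump eta s + `|t - s| / eta.
Proof.
move=> eta0; have : `|s| / eta <= `|t| / eta + `|t - s| / eta.
  rewrite -mulrDl ler_pM2r ?invr_gt0// distrC.
  by have := ler_normD t (s - t); rewrite addrC subrK.
have : 0 <= `|t - s| / eta by rewrite divr_ge0// ltW.
rewrite /bump !maxEle !minEle => h1 h2.
case: (leP 1 (2 - `|t| / eta)) => ht; case: (leP 1 (2 - `|s| / eta)) => hs;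
  rewrite ?ler01; try by lra.
- by case: (leP 0 (2 - `|s| / eta)) => h3; lra.
- by case: (leP 0 (2 - `|t| / eta)) => h3; lra.
- by case: (leP 0 (2 - `|t| / eta)) => h3; case: (leP 0 (2 - `|s| / eta)) => h4; lra.
Qed.

Lemma bump_continuous (X : topologicalType) eta (f : X -> R) : continuous f ->
  continuous (fun x => bump eta (f x)).
Proof. by move=> cf; rewrite /bump; cts. Qed.

(* The bump is supported in [-2 eta, 2 eta], so its translates by multiples of
   [4 * eta] have disjoint interiors of supports. *)
Lemma sum_bump_le1 n eta t : 0 < eta -> \sum_(k < n) bump eta (t + k%:R * (4 * eta)) <= 1.
Proof.
move=> eta0.
have [[k kt]|nk] := pselect (exists k : 'I_n, `|t + k%:R * (4 * eta)| < 2 * eta).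
  rewrite (bigD1 k)//= big1 ?addr0 ?bump_le1// => j jk; apply: bump_eq0 => //.
  have : 4 * eta <= `|(j%:R - k%:R) * (4 * eta)|.
    rewrite normrM [X in _ <= _ * X]gtr0_norm ?mulr_gt0// ler_peMl ?mulr_ge0 ?(ltW eta0)//.
    have [h|h|h] := ltngtP j k; last by move: jk; rewrite -(inj_eq val_inj) /= h eqxx.
      have : j.+1%:R <= k%:R :> R by rewrite ler_nat.
      by rewrite -natr1 => h1; rewrite ler0_norm; lra.
    have : k.+1%:R <= j%:R :> R by rewrite ler_nat.
    by rewrite -natr1 => h1; rewrite ger0_norm; lra.
  have -> : (j%:R - k%:R) * (4 * eta) =
     (t + j%:R * (4 * eta)) - (t + k%:R * (4 * eta)) by ring.
  have := ler_normB (t + j%:R * (4 * eta)) (t + k%:R * (4 * eta)); lra.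
rewrite big1// => k _; apply: bump_eq0 => //; rewrite leNgt; apply/negP => h.
by apply: nk; exists k.
Qed.

End Bump.

Section Perturbation.
Variables (R : realType) (G : groupType) (X : ptopologicalType).
Variable alpha : continuous_action G X.
Hypotheses (aG : amenable R G) (cX : compact [set: X]) (perf : perfect_space R X).
Hypothesis cE : compact (E_G R alpha).
Hypothesis dimE : covering_dim_le (set_type (E_G R alpha)) 0.
Let E := E_G R alpha.

(** In dimension zero the cover has an open refinement with exactly one member through each point of
    [E]; each member picks one index, so the index is locally constant. Off [E] the index is a junk
    value. *)
Lemma locally_constant_selection (n : nat) (O : nat -> set (functionals R X)) :
  (forall k, open (O k)) -> (forall q, E q -> exists2 k, (k < n)%N & O k q) ->
  exists kappa : functionals R X -> nat,
    (forall q, E q -> (kappa q < n)%N /\ O (kappa q) q) /\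
    forall q, E q -> exists2 U, nbhs q U & forall r, E r -> U r -> kappa r = kappa q.
Proof.
move=> oO EO.
pose O' k : set (set_type E) := set_val @^-1` (O k).
have memE q (Eq : E q) : q \in E by exact: mem_set.
have [| | |V [_ oV Vcov Vref Vdisj]] := dimE (U := O' @` `I_n).
- exact: finite_image.
- by move=> _ [k _ <-]; exists (O k).
- apply/seteqP; split => // x _.
  have [k kn Ok] := EO (set_val x) (set_mem (valP x)).
  by exists (O' k) => //; exists k.
have Vuniq x B1 B2 : V B1 -> V B2 -> B1 x -> B2 x -> B1 = B2.
  move=> V1 V2 B1x B2x; have /pcard_leP[f] := Vdisj x.
  apply: (@inj _ _ _ f); rewrite ?inE//.
  have : (f B1 < 1)%N by exact: (@funS _ _ _ _ f B1 (conj V1 B1x)).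
  have : (f B2 < 1)%N by exact: (@funS _ _ _ _ f B2 (conj V2 B2x)).
  by rewrite !ltnS !leqn0 => /eqP h2 /eqP h1; exact: etrans h1 (esym h2).
have /choice[h hP] (B : set (set_type E)) : exists k, V B -> (k < n)%N /\ B `<=` O' k.
  have [VB|] := pselect (V B); last by exists 0%N.
  by have [_ [k kn <-] BO] := Vref B VB; exists k.
have /choice[kappa kP] (q : functionals R X) :
    exists k, forall (Eq : q \in E) B, V B -> B (SigSub Eq) -> k = h B.
  have [Eq|nEq] := pselect (q \in E : Prop); last by exists 0%N => Eq; case: nEq.
  have [B VB Bq] : (\bigcup_(B in V) B) (SigSub Eq) by rewrite Vcov.
  exists (h B) => Eq' B' VB'; rewrite (bool_irrelevance Eq' Eq) => B'q.
  by rewrite (Vuniq _ _ _ VB VB' Bq B'q).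
have pick q (Eq : q \in E) : exists B, [/\ V B, B (SigSub Eq) & kappa q = h B].
  have [B VB Bq] : (\bigcup_(B in V) B) (SigSub Eq) by rewrite Vcov.
  by exists B; split => //; exact: kP Bq.
exists kappa; split=> q /memE Eq; have [B [VB Bq kE]] := pick q Eq.
  by have [kn BO] := hP B VB; rewrite kE; split => //; exact: (BO _ Bq).
have [W oW WB] := oV B VB.
exists W; first by apply: open_nbhs_nbhs; split => //; move: Bq; rewrite -WB.
move=> r /memE Er Wr; rewrite kE; apply: (kP r Er B VB).
by rewrite -WB.
Qed.

Lemma perturbation (f : X -> R) e d : continuous f -> 0 < e -> 0 < d ->
  exists g eta, [/\ continuous g, forall x, `|g x - f x| <= e, 0 < eta &
    forall q, M_G R alpha q -> ev q (fun x => bump eta (g x)) <= d].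
Proof.
move=> cf e0 d0.
(* The bound 3/N splits into 2/N from the selected cutoff and 1/N from an L^1 error [eta / N]
   multiplied by the Lipschitz constant 1/eta. The spacing [4 * eta = e / N] keeps the [N] cutoffs
   disjoint and all shifts at most [e]. *)
pose N := (Num.truncn (3 / d)).+1.
have N0 : 0 < N%:R :> R by rewrite ltr0n.
have Nd : 3 / N%:R <= d.
  by rewrite ler_pdivrMr// -ler_pdivrMl// mulrC; exact/ltW/truncnS_gt.
pose eta := e / N%:R / 4.
have eta0 : 0 < eta by rewrite !divr_gt0.
have eta4 : 4 * eta = e / N%:R by rewrite /eta mulrC divfK.
pose F k x := bump eta (f x + k%:R * (4 * eta)).
have cF k : continuous (F k) by apply: bump_continuous; cts.
(* The [N] integrals add up to at most 1, so one is at most 1/N; the strict bound 2/N is used to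
   make the condition open in q. *)
have [|q Eq|kappa [kO kloc]] := @locally_constant_selection N
    (fun k => [set q | ev q (F k) < 2 / N%:R]).
- by move=> k; apply: open_lt_continuous; exact: ev_continuous.
- have sq := E_G_state cX perf Eq; apply: contrapT => nk.
  have : \sum_(k < N) ev q (F k) <= 1.
    rewrite -(state_sum sq _ cF) -[leRHS](state_cst sq).
    apply: (le_state sq); [|exact: cts_cst|by move=> x; exact: sum_bump_le1].
    elim: (N) => [|m IH]; first by under eq_fun do rewrite big_ord0; exact: cts_cst.
    by under eq_fun do rewrite big_ord_recr/=; apply: cts_add => //; exact: cF.
  apply/negP; rewrite -ltNge; apply: lt_le_trans (_ : \sum_(k < N) 2 / N%:R <= _).
    by rewrite sumr_const card_ord -[X in _ < X]mulr_natr divfK ?gt_eqF//; lra.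
  apply: ler_sum => k _; rewrite leNgt; apply/negP => h; apply: nk.
  by exists k.
pose c q : R := (kappa q)%:R * (4 * eta).
have [h ch Hh] : exists2 h : X -> R, continuous h &
    forall q, E q -> ev q (fun x => `|h x - c q|) <= eta / N%:R.
  apply: (approximable_locally_constant aG cX perf cE) => [q Eq|]; last first.
    by rewrite divr_gt0.
  by have [U Uq kU] := kloc q Eq; exists U => // r Er Ur; rewrite /c (kU r).
(* Clipping to [0, e] bounds the perturbation by [e] and does not increase the distance to [c q],
   which lies in that interval. *)
pose h' x := Num.max 0 (Num.min e (h x)).
have ch' : continuous h' by rewrite /h'; cts.
exists (fun x => f x + h' x), eta.
have cfh : continuous (fun x => f x + h' x) by cts.
split => //.
  move=> x; rewrite addrC addrA [- _ + _]addrC subrr add0r.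
  rewrite ger0_norm ?le_max ?lexx// ge_max (ltW e0)/= ge_min lexx//.
have cb := bump_continuous (eta := eta) cfh.
have [k kE] := evP (fun=> 0) cb.
suff Eb q : extreme_points (M_G R alpha) q -> q k <= d.
  by move=> q Mq; rewrite kE; exact: (ler_extreme_points (M_G_compact cX perf) Eb).
move=> Eq; rewrite -kE; have sq := E_G_state cX perf Eq.
have [kN Ok] := kO q Eq.
have c01 : 0 <= c q <= e.
  rewrite /c eta4 mulr_ge0 ?divr_ge0 ?(ltW e0)//= mulrCA ger_pMr//.
  by rewrite ler_pdivrMr// mul1r ler_nat ltnW.
apply: le_trans Nd; have := Hh q Eq.
have : ev q (fun x => bump eta (f x + h' x)) <= ev q (F (kappa q)) +
    eta^-1 * ev q (fun x => `|h x - c q|).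
  rewrite -(stateZ sq); last by cts.
  have ck := cF (kappa q).
  rewrite -(stateD sq)//; last by cts.
  apply: (le_state sq) => //; first by cts.
  move=> x; apply: le_trans (bump_lipschitz _ (f x + c q) eta0) _.
  rewrite lerD2l mulrC ler_pM2l ?invr_gt0//.
  have -> : f x + h' x - (f x + c q) = h' x - c q by ring.
  case/andP: c01 => c0 ce.
  rewrite /h' !maxEle !minEle; case: (leP e (h x)) => h1.
    by rewrite (ltW e0) !ger0_norm; lra.
  by case: ifP => h2//; rewrite !ler0_norm; lra.
move: Ok => /= Ok h1 h2.
have : eta^-1 * ev q (fun x => `|h x - c q|) <= N%:R^-1.
  by rewrite ler_pdivrMl.
lra.
Qed.

End Perturbation.

(** * Functions whose zero set is null for every invariant measure *)

Section SmallLevelSets.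
Variables (R : realType) (G : groupType) (X : ptopologicalType).
Variable alpha : continuous_action G X.
Hypotheses (aG : amenable R G) (cX : compact [set: X]) (perf : perfect_space R X).
Hypothesis cE : compact (E_G R alpha).
Hypothesis dimE : covering_dim_le (set_type (E_G R alpha)) 0.

Lemma closed_measure_le (mu : probability (borel X) R) (Z : set X) (f : X -> R) :
  closed Z -> continuous f -> (forall x, 0 <= f x) -> (forall x, Z x -> 1 <= f x) ->
  (mu Z <= (\int[mu]_(x in [set: borel X]) f x)%:E)%E.
Proof.
move=> cZ cf f0 fZ; have mZ := closed_borel cZ.
rewrite /Rintegral fineK; last first.
  by apply: integrable_fin_num => //; exact: (continuous_integrable cX).
have -> : mu Z = (\int[mu]_(x in [set: borel X]) (\1_(Z : set (borel X)) x)%:E)%E.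
  by rewrite integral_indic// setIT.
apply: ge0_le_integral => //.
- by apply/measurable_EFinP; exact: measurable_indic.
- by apply/measurable_EFinP; exact: continuous_borel_measurable.
- move=> x _; rewrite lee_fin indicE; have [|] := boolP (x \in _).
    by rewrite inE => /fZ.
  by rewrite f0.
Qed.

(* Iterated perturbations converge uniformly to [F]; the zero set of [F] stays
   inside the plateau of the n-th bump. *)
Lemma exists_small_zero_set (f : X -> R) e : continuous f -> 0 < e ->
  exists F, [/\ continuous F, forall x, `|F x - f x| <= e &
    forall mu : probability (borel X) R, invariant_measure alpha mu ->
      mu [set x | F x = 0] = 0%E].
Proof.
move=> cf e0.
(* A stage is a function with a budget bounding its distance to all later stages. At most half is
   spent on the next step and at most half handed on. The new budget is also at most [eta], which
   forces |g| <= eta wherever the limit vanishes. *)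
pose T := {s : (X -> R) * R | continuous s.1 /\ 0 < s.2}.
pose step (n : nat) (s s' : T) := [/\ forall x, `|(sval s').1 x - (sval s).1 x| <= (sval s).2 / 2,
   (sval s').2 <= (sval s).2 / 2, (sval s').2 <= n.+1%:R^-1 &
   exists eta, [/\ 0 < eta, (sval s').2 <= eta &
     forall q, M_G R alpha q -> ev q (fun x => bump eta ((sval s').1 x)) <= n.+1%:R^-1]].
have /choice[next nextP] (ns : nat * T) : exists s', step ns.1 ns.2 s'.
  case: ns => n [[g d] /= [cg d0]].
  have n0 : 0 < (n.+1%:R^-1 : R) by rewrite invr_gt0.
  have d2 : 0 < d / 2 by rewrite divr_gt0.
  have [g' [eta [cg' gg' eta0 H]]] := perturbation aG cX perf cE dimE cg d2 n0.
  pose d' := Num.min (d / 2) (Num.min n.+1%:R^-1 eta).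
  have d'0 : 0 < d' by rewrite !lt_min d2 n0 eta0.
  exists (exist _ (g', d') (conj cg' d'0)); split => //=.
  - by rewrite ge_min lexx.
  - by rewrite !ge_min lexx orbT.
  - by exists eta; split => //; rewrite !ge_min lexx !orbT.
pose s := fix s n : T := if n is m.+1 then next (m, s m) else exist _ (f, e) (conj cf e0).
pose g n := (sval (s n)).1; pose d n := (sval (s n)).2.
have cg n : continuous (g n) by case: (svalP (s n)).
have d0 n : 0 < d n by case: (svalP (s n)).
have sP n : step n (s n) (s n.+1) by exact: (nextP (n, s n)).
have gg n k x : `|g (n + k)%N x - g n x| <= d n - d (n + k)%N.
  elim: k => [|k IH]; first by rewrite addn0 !subrr normr0.
  have [h1 h2 _ _] := sP (n + k)%N; rewrite addnS.
  have := ler_distD (g (n + k)%N x) (g (n + k).+1 x) (g n x).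
  have := h1 x; move: IH h2; rewrite -/(g _) -/(d _) -/(g (n + k).+1) -/(d (n + k).+1) /=; lra.
have gd n m x : (n <= m)%N -> `|g m x - g n x| <= d n.
  by move=> nm; have := gg n (m - n)%N x; rewrite subnKC// => h; have := d0 m; lra.
have dsmall n : d n.+1 <= n.+1%:R^-1 by case: (sP n).
have small r : 0 < r -> exists n : nat, n.+1%:R^-1 <= r :> R.
  move=> r0; exists (Num.truncn r^-1).
  by rewrite -[leRHS]invrK lef_pV2 ?posrE ?invr_gt0//; exact/ltW/truncnS_gt.
have /choice[F FP] x : exists l, forall r, 0 < r -> exists N, forall n, (N <= n)%N -> `|g n x - l| <= r.
  apply: real_cauchy_limit => r r0; have r2 : 0 < r / 2 by rewrite divr_gt0.
  have [N HN] := small _ r2; exists N.+1 => n m Nn Nm /=.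
  have := ler_distD (g N.+1 x) (g n x) (g m x).
  have := gd _ _ x Nn; have := gd _ _ x Nm; have := le_trans (dsmall N) HN.
  rewrite (distrC (g N.+1 x)); lra.
have Fg n x : `|F x - g n x| <= d n.
  apply/ler_addgt0Pr => r r0; have [N HN] := FP x r r0.
  have := HN _ (leq_maxl N n); have := gd _ _ x (leq_maxr N n).
  have := ler_distD (g (maxn N n) x) (F x) (g n x).
  rewrite (distrC (F x) (g (maxn N n) x)); lra.
have cF : continuous F.
  move=> x; apply/cvgrPdist_le => r r0; have r3 : 0 < r / 3 by rewrite divr_gt0.
  have [n Hn] := small _ r3; have /cvgrPdist_le/(_ _ r3) := cg n.+1 x.
  apply: filterS => y gy; have := Fg n.+1 x; have := Fg n.+1 y; have := le_trans (dsmall n) Hn.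
  have := ler_distD (g n.+1 x) (F x) (F y).
  have := ler_distD (g n.+1 y) (g n.+1 x) (F y).
  rewrite (distrC (F y)); move: gy; lra.
exists F; split => //; first by move=> x; exact: (Fg 0%N).
move=> mu imu; apply/eqP; rewrite eq_le measure_ge0 andbT.
have MG : M_G R alpha (functional_of mu) by exists mu.
apply/lee_addgt0Pr => r r0; rewrite add0e.
have [n Hn] := small _ r0; have [_ _ _ [eta [eta0 deta H]]] := sP n.
have cb := bump_continuous (eta := eta) (cg n.+1).
apply: le_trans (closed_measure_le mu _ cb (fun=> bump_ge0 _ _) _) _.
- by apply: (@preimage_closed _ _ F [set 0]) => //; exact: closed_eq.
- move=> x /= Fx; rewrite bump_eq1//; apply: le_trans deta.
  by have := Fg n.+1 x; rewrite Fx sub0r normrN.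
- rewrite lee_fin; apply: le_trans Hn; have := H _ MG.
  by rewrite /ev; case: pselect.
Qed.

End SmallLevelSets.

Theorem theorem1p1 (R : realType) (G : groupType) (X : ptopologicalType)
    (alpha : continuous_action G X)
    (G_countable : countable [set: G])
    (G_infinite : infinite_set [set: G])
    (G_amenable : amenable R G)
    (X_infinite : infinite_set [set: X])
    (X_compact : compact [set: X])
    (X_metrizable : metrizable R X)
    (alpha_minimal : minimal_action alpha)
    (alpha_free : free_action alpha)
    (EG_compact : compact (E_G R alpha))
    (EG_zero_dim : covering_dim_le (set_type (E_G R alpha)) 0) :
  small_boundary_property R alpha.
Proof.
move=> x U oU Ux.
have perf := metrizable_perfect X_metrizable.
have [u [cu u0 uU]] := perf U oU.
have ux : 0 < u x by exact/uU.
have ux4 : 0 < u x / 4 by rewrite divr_gt0.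
(* The shift by [u x / 2] with tolerance [u x / 4] leaves [F x >= u x / 4], and [F <= - u x / 4] off
   [U]. *)
have cf : continuous (fun y => u y - u x / 2) by cts.
have [F [cF Ff mF]] :=
  exists_small_zero_set G_amenable X_compact perf EG_compact EG_zero_dim cf ux4.
exists [set y | 0 < F y]; split.
- exact: open_gt_continuous.
- by have := Ff x; rewrite ler_norml /=; lra.
- move=> y /= Fy; apply: contrapT => nUy.
  have uy : u y = 0.
    by apply/eqP; rewrite eq_le u0 andbT leNgt; apply/negP => /uU.
  by have := Ff y; rewrite ler_norml uy; lra.
- move=> mu imu; apply/eqP; rewrite eq_le measure_ge0 andbT -(mF mu imu).
  have cZ : closed [set y | F y = 0].
    by apply: (@preimage_closed _ _ F [set 0]) => //; exact: closed_eq.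
  have oV : open [set y | 0 < F y] by exact: open_gt_continuous.
  apply: le_measure; rewrite ?inE.
  + apply: measurableD; first by apply: closed_borel; exact: closed_closure.
    exact: open_borel.
  + exact: closed_borel.
  + move=> y [clV nV]; apply/eqP; rewrite eq_le.
    have cge : closed [set z | 0 <= F z].
      by apply: (@preimage_closed _ _ F [set z | 0 <= z]) => //; exact: closed_ge.
    apply/andP; split; first by rewrite leNgt; apply/negP.
    suff : closure [set z | 0 <= F z] y by rewrite -(closure_id _).1.
    by apply: closureS clV => z /ltW.
Qed.
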